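(* Let $n\ge 2$ and let $\xi_1,\ldots,\xi_n$ be independent real-valued random variables with finite moments of all positive orders, $\xi_i$ having distribution function $F_i$. Let each $F_i$ be absolutely continuous with a density $f_i>0$ on $\mathbb{R}$ that is symmetric about $0$. Assume further that the following conditions are satisfied: (i) At least one of the densities $f_1(x),\ldots,f_n(x)$ is decreasing in $x\ge x_0$, where $x_0\ge 1$ is a constant. (ii) For each $i=1,2,\ldots,n$, there exists a constant $A_i>0$ such that, with $\overline{F_i}=1-F_i$, $$\frac{f_i(x)}{\overline{F_i}(x)}\ge \frac{A_i}{x}\quad\text{for } x\ge x_0,$$ and there exist constants $B_i>0$, $\alpha_i>0$, $\beta_i>0$ and real $\gamma_i$ such that $$\overline{F_i}(x)\ge B_i x^{\gamma_i}e^{-\alpha_i x^{\beta_i}}\quad\text{for } x\ge x_0.$$ If, in addition to conditions (i) and (ii), $\sum_{i=1}^n\frac{1}{\beta_i}>1$, then the product $Z_n=\xi_1\xi_2\cdots\xi_n$ is M-indet.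
   Context: A random variable $X$ with distribution function $F$ and moments $m_k=\mathbf{E}[X^k]$ (all finite) is called moment determinate (M-det) if $F$ is the only distribution having the moment sequence $\{m_k\}_{k=1}^\infty$; otherwise it is called moment indeterminate (M-indet). *)

(* Defs.v *)
From HB Require Import structures.
From mathcomp Require Export all_boot all_order all_algebra.
From mathcomp Require Export all_classical all_reals all_analysis.

Set Implicit Arguments.
Unset Strict Implicit.
Unset Printing Implicit Defensive.

Import Order.TTheory GRing.Theory Num.Theory.
Import numFieldNormedType.Exports.

Local Open Scope classical_set_scope.
Local Open Scope ring_scope.

Definition mutually_independent d (T : measurableType d) (R : realType)
    (P : probability T R) (I : finType) (X : I -> {RV P >-> R}) : Prop :=
  forall (J : {set I}) (A : I -> set R), (forall i, measurable (A i)) ->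
    P (\bigcap_(i in [set i | i \in J]) (X i @^-1` A i)) =
    (\prod_(i in J) P (X i @^-1` A i))%E.
Arguments mutually_independent {d T R} P {I} X.

Definition has_density d (T : measurableType d) (R : realType)
    (P : probability T R) (X : {RV P >-> R}) (f : R -> R) : Prop :=
  [/\ measurable_fun setT f,
      forall x, 0 <= f x &
      forall A, measurable A ->
        distribution P X A = (\int[lebesgue_measure]_(x in A) (f x)%:E)%E].
Arguments has_density {d T R} P X f.

(* [cdf] takes values in the extended reals; it is always finite, so [fine]
   loses nothing. *)
Definition tail d (T : measurableType d) (R : realType)
    (P : probability T R) (X : {RV P >-> R}) (x : R) : R :=
  1 - fine (cdf X x).
Arguments tail {d T R} P X x.

(* Integrability of X^k means that E|X|^k is finite. *)
Definition finite_moments d (T : measurableType d) (R : realType)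
    (P : probability T R) (X : {RV P >-> R}) : Prop :=
  forall k, (0 < k)%N -> P.-integrable setT (fun w => (X w ^+ k)%:E).
Arguments finite_moments {d T R} P X.

Definition moment d (T : measurableType d) (R : realType)
    (P : probability T R) (X : {RV P >-> R}) (k : nat) : \bar R :=
  ('E_P[fun w => (X w ^+ k)%R])%E.
Arguments moment {d T R} P X k.

(* A distribution is a probability measure on the Borel sets of R.  The
   integral of a non-integrable function is a junk value, whence the explicit
   integrability requirement. *)
Definition has_moment_sequence (R : realType)
    (nu : probability (measurableTypeR R) R) (m : nat -> \bar R) : Prop :=
  forall k, (0 < k)%N ->
    nu.-integrable setT (fun x : R => (x ^+ k)%:E) /\
    (\int[nu]_x (x ^+ k)%:E)%E = m k.

Definition unique_distribution d (T : measurableType d) (R : realType)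
    (P : probability T R) (X : {RV P >-> R}) : Prop :=
  forall nu : probability (measurableTypeR R) R,
    has_moment_sequence nu (moment P X) ->
    forall A, measurable A -> nu A = distribution P X A.
Arguments unique_distribution {d T R} P X.

(* Determinacy and indeterminacy are only meaningful when all moments are
   finite; this is part of both definitions. *)
Definition M_det d (T : measurableType d) (R : realType)
    (P : probability T R) (X : {RV P >-> R}) : Prop :=
  finite_moments P X /\ unique_distribution P X.
Arguments M_det {d T R} P X.

Definition M_indet d (T : measurableType d) (R : realType)
    (P : probability T R) (X : {RV P >-> R}) : Prop :=
  finite_moments P X /\ ~ M_det P X.
Arguments M_indet {d T R} P X.

Section product_RV.
Context d (T : measurableType d) (R : realType) (P : probability T R).
Context (I : finType) (X : I -> {RV P >-> R}).

Definition product_RV (w : T) : R := \prod_(i : I) X i w.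

Let measurable_product_RV : measurable_fun setT product_RV.
Proof. by apply: measurable_prod => i _; exact: measurable_funPT. Qed.

HB.instance Definition _ := isMeasurableFun.Build _ _ _ _ product_RV
  measurable_product_RV.

End product_RV.
Arguments product_RV {d T R} P {I} X w.

(* Main.v *)
From HB Require Import structures.
Require Import Defs.
From mathcomp Require Import measurable_realfun ring lra.

Set Implicit Arguments.
Unset Strict Implicit.
Unset Printing Implicit Defensive.

Import Order.TTheory GRing.Theory Num.Theory.
Import numFieldNormedType.Exports.

Local Open Scope classical_set_scope.
Local Open Scope ring_scope.

(** Krein's theorem suggests the result: the density of the product [Z] decays
    more slowly than [exp (- |z| ^ eta)] for some [eta < 1].  Here the second law
    with the moments of [Z] is written down: it is the law of [Z] plus a signed
    density, odd, supported far from the origin, all of whose moments vanish and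
    which is smaller than the density of [Z].

    The signed density.  Let [0 < lam < 1/2], [a = cos (pi * lam)] and
    [b = sin (pi * lam)].  On [x >= c], [bump] is a constant multiple of
    [exp (- a * t) * sin (b * t)] with [t = (x ^ 2 - c ^ 2) ^ lam]; [odd_bump] is its
    odd extension, zero on [|x| < c].  Its even moments vanish by parity.  An odd
    power of [x] is a combination of the functions [x * (x ^ 2 - c ^ 2) ^ j], and
    with [u = x ^ 2 - c ^ 2] the integral of [x * (x ^ 2 - c ^ 2) ^ j * bump x] becomes
    Stieltjes' integral of [u ^ j * exp (- a * u ^ lam) * sin (b * u ^ lam)] on the
    half-line.  Up to sign this is the imaginary part of a Gamma integral along a ray,
    which is a real number times [exp (i * (j + 1) * pi)]: it vanishes.  The rotation of the
    ray is carried out on real integrals.  The integral over [[c, X]] of [wave j th]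
    vanishes at [th = 0], is a multiple of the wanted one at [th = pi * lam], and its
    derivative in [th] is the boundary value of [wave_prim j th] at [X], which tends
    to 0 as [X] grows ([le_integral_wave], [integral_gap_bump], [integral_odd_bump0]).
    The size of [odd_bump] is at most [exp (- a * |x| ^ (2 * lam))] ([odd_bump_bound]).

    The lower bound.  Let [rho] be the inverse of the sum of the [1 / beta i], so that
    [rho < 1], and [w i = rho / beta i], so that the [w i] sum to 1.  The product has
    size [X] when each factor [i] has size [X ^ w i], where its tail is at least
    [exp (- alpha i * X ^ rho)] up to constants and powers of [X].  The hazard
    condition turns bounds on tails into bounds on densities
    ([density_ge_hazard_floor]); integrating the density of one factor against the
    law of the product of the others ([independent_product_law_ge]) shows that, for
    all [eta > rho] and [e > 0], the law of [Z] dominates [exp (- e * X ^ eta)] times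
    the Lebesgue measure on [X <= |z| <= 2 * X] for [X] large
    ([product_law_ge_subexponential]).

    Conclusion.  Choose [rho < 2 * lam < 1] and [c] large.  The law of [Z] plus
    [odd_bump] is nonnegative on the shells [n <= |z| < n + 1], hence everywhere
    ([odd_bump_perturbation_ge0]); it is a probability with the moments of [Z]
    ([integral_perturbed_probability]) and it differs from the law of [Z] because
    [odd_bump] is not null ([odd_bump_neq0]).  The cut at [c] is essential: the
    densities may be arbitrarily small near the origin, and so may that of [Z]. *)

(** * Powers and exponentials *)

Lemma cvg_powR0 (R : realType) (lam : R) : 0 < lam ->
  `|u| `^ lam @[u --> (0:R)] --> (0:R).
Proof.
move=> lam0.
apply/cvgrPdist_lt => /= e e0.
have small : \forall u \near (0:R), `|u| < e `^ lam^-1.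
  by apply: nbhs0_lt; rewrite powR_gt0.
near=> u.
rewrite sub0r normrN ger0_norm ?powR_ge0//.
have [->|u0] := eqVneq u 0; first by rewrite normr0 powR0// gt_eqF.
rewrite -[ltRHS](@powRr1 _ e) ?ltW// -(@mulVf _ lam) ?gt_eqF//.
rewrite powRrM; apply: gt0_ltr_powR; rewrite ?nnegrE ?powR_ge0//.
by near: u; exact: small.
Unshelve. all: by end_near. Qed.

(** A negative base has power 1, so the absolute value is what makes the power
    continuous across 0. *)
Lemma continuous_normr_powR (R : realType) (lam : R) : 0 < lam ->
  continuous (fun u : R => `|u| `^ lam).
Proof.
move=> lam0 u; have [->|u0] := eqVneq u 0.
  by rewrite /continuous_at normr0 powR0 ?gt_eqF//; exact: cvg_powR0.
apply: (@continuous_comp _ _ _ (fun v : R => `|v|) (fun v : R => v `^ lam)).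
  exact: norm_continuous.
apply/differentiable_continuous/derivable1_diffP.
by apply: derivable_powR; rewrite in_itv/= andbT normr_gt0.
Qed.

(** Choose a natural number [n] with [u ^ p <= (u ^ lam) ^ (n + 1)] for [u >= 1] and
    compare with the term of degree [n + 1] of the exponential series. *)
Lemma powR_expR_bounded (R : realType) (p a lam : R) : 0 < a -> 0 < lam ->
  exists2 C, 0 < C &
    forall u, 1 <= u -> u `^ p * expR (- (a * u `^ lam)) <= C.
Proof.
move=> a0 lam0.
have [n /ltW np] : exists n, p / lam < n%:R.
  by exists (Num.truncn `|p / lam|).+1; apply: le_lt_trans (ler_norm _) (truncnS_gt _).
exists (n.+1`!%:R / a ^+ n.+1).
  by rewrite divr_gt0 ?exprn_gt0// ltr0n fact_gt0.
move=> u u1; set t := u `^ lam.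
have t0 : 0 <= t by exact: powR_ge0.
have upt : u `^ p <= t ^+ n.+1.
  rewrite -powR_mulrn// -powRrM ler_powR//.
  rewrite mulrC -ler_pdivrMr// (le_trans np)//.
  by rewrite ler_nat.
have : (a * t) ^+ n.+1 / n.+1`!%:R <= expR (a * t).
  apply: le_trans (expR_ge1Dxn n _); last by rewrite mulr_ge0// ltW.
  by rewrite lerDr.
rewrite ler_pdivrMr ?ltr0n ?fact_gt0// exprMn => H.
rewrite expRN ler_pdivrMr ?expR_gt0// mulrAC ler_pdivlMr ?exprn_gt0//.
apply: le_trans (ler_wpM2r _ upt) _; first by rewrite exprn_ge0// ltW.
by rewrite mulrC (le_trans H)// mulrC.
Qed.

(** Since [r <= 1], a share [s] of the total, [0 < s <= 1], satisfies [s <= s ^ r]; the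
    shares [u / (u + v)] and [v / (u + v)] add up to 1. *)
Lemma powR_subadd (R : realType) (u v r : R) : 0 <= u -> 0 <= v -> 0 < r <= 1 ->
  (u + v) `^ r <= u `^ r + v `^ r.
Proof.
move=> u0 v0 /andP[r0 r1]; have [->|u_neq0] := eqVneq u 0.
  by rewrite add0r lerDr powR_ge0.
have [->|v_neq0] := eqVneq v 0; first by rewrite addr0 lerDl powR_ge0.
have ugt0 : 0 < u by rewrite lt_neqAle eq_sym u_neq0.
have vgt0 : 0 < v by rewrite lt_neqAle eq_sym v_neq0.
have w0 : 0 < u + v by exact: addr_gt0.
have part (x : R) : 0 < x -> x <= u + v -> x / (u + v) * (u + v) `^ r <= x `^ r.
  move=> x0 xw; rewrite -[in leRHS](@divfK _ (u + v) _ x) ?gt_eqF//.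
  have xw0 : 0 <= x / (u + v) by rewrite divr_ge0 ?(ltW x0) ?(ltW w0).
  rewrite [leRHS]powRM ?(ltW w0)// ler_wpM2r ?powR_ge0//.
  by rewrite ger1_powR// divr_gt0//= ler_pdivrMr// mul1r.
rewrite -[leLHS]mul1r -(@divff _ (u + v)) ?gt_eqF// [X in X * _]mulrDl mulrDl.
by rewrite lerD// part// ?lerDl ?lerDr.
Qed.

Lemma powR_sum (R : realType) (I : Type) (s : seq I) (Q : pred I) (x : R) (w : I -> R) :
  0 < x -> x `^ (\sum_(i <- s | Q i) w i) = \prod_(i <- s | Q i) x `^ w i.
Proof.
move=> x0; elim/big_rec2 : _ => [|i y1 y2 _ <-]; first by rewrite powRr0.
by rewrite powRD// (gt_eqF x0) implybT.
Qed.

(** * Rotating a Gamma integral *)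

(** The rules of differentiation for functions given by an expression; the value of
    the derivative is constrained by an equation, so that the rules chain by
    unification and arithmetic is left to the end. *)
Section derive_fun.
Context {R : realType}.
Implicit Types (f g : R -> R) (x a b d k : R).

Lemma is_derive_comp_fun f g x a b d : is_derive (g x) 1 f a ->
  is_derive x 1 g b -> a * b = d -> is_derive x 1 (fun y => f (g y)) d.
Proof. by move=> df dg <-; exact: is_derive1_comp. Qed.

Lemma is_deriveM_fun f g x a b d : is_derive x 1 f a -> is_derive x 1 g b ->
  f x * b + g x * a = d -> is_derive x 1 (fun y => f y * g y) d.
Proof. by move=> df dg <-; exact: is_deriveM. Qed.

Lemma is_deriveB_fun f g x a b d : is_derive x 1 f a -> is_derive x 1 g b ->
  a - b = d -> is_derive x 1 (fun y => f y - g y) d.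
Proof. by move=> df dg <-; exact: is_deriveB. Qed.

Lemma is_deriveN_fun f x a d : is_derive x 1 f a -> - a = d ->
  is_derive x 1 (fun y => - f y) d.
Proof. by move=> df <-; exact: is_deriveN. Qed.

Lemma is_deriveZ_fun k f x a d : is_derive x 1 f a -> k * a = d ->
  is_derive x 1 (fun y => k * f y) d.
Proof. by move=> df <-; exact: is_deriveZ. Qed.

Lemma is_deriveX_fun f n x a d : is_derive x 1 f a -> n.+1%:R * f x ^+ n * a = d ->
  is_derive x 1 (fun y => f y ^+ n.+1) d.
Proof.
move=> df <-.
by have := is_deriveX n.+1 df; rewrite exprfctE.
Qed.

End derive_fun.

Section rotation.
Context (R : realType) (c lam : R).
Hypotheses (c0 : 0 <= c) (lam0 : 0 < lam).
Implicit Types (th x : R) (j : nat).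

(** This is [(x ^ 2 - c ^ 2) ^ lam] on [x >= c]; the absolute value makes it
    continuous on the whole line. *)
Definition gap_powR x : R := `|x ^+ 2 - c ^+ 2| `^ lam.
Local Notation rad := gap_powR.
Definition phase j th x : R := j.+1%:R / lam * th - rad x * sin th.

(** With [u = x ^ 2 - c ^ 2] and [p = j + 1], these are the imaginary part of
    [2 * x * u ^ j * exp (i * p * th / lam) * exp (- u ^ lam * exp (i * th))] and the
    real part of [u ^ p / lam * exp (i * p * th / lam) * exp (- u ^ lam * exp (i * th))].
    The derivative of the first in [th] is the derivative of the second in [x]; this
    common value is [wave_der]. *)
Definition wave j th x : R :=
  2 * x * (x ^+ 2 - c ^+ 2) ^+ j * (expR (- (rad x * cos th)) * sin (phase j th x)).
Definition wave_prim j th x : R :=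
  lam^-1 * (x ^+ 2 - c ^+ 2) ^+ j.+1 * (expR (- (rad x * cos th)) * cos (phase j th x)).
Definition wave_der j th x : R :=
  2 * x * (x ^+ 2 - c ^+ 2) ^+ j *
  (expR (- (rad x * cos th)) *
   (rad x * sin th * sin (phase j th x)
    + (j.+1%:R / lam - rad x * cos th) * cos (phase j th x))).

Lemma is_derive_wave_angle j th x :
  is_derive th 1 (wave j ^~ x) (wave_der j th x).
Proof.
have de : is_derive th 1 (fun th => expR (- (rad x * cos th)))
    (rad x * sin th * expR (- (rad x * cos th))).
  by apply: (@is_derive_comp_fun _ expR); rewrite /GRing.scale/=; ring.
have dp : is_derive th 1 (phase j ^~ x) (j.+1%:R / lam - rad x * cos th).
  apply: is_deriveB_fun; rewrite /GRing.scale/=; ring.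
have ds : is_derive th 1 (fun th => sin (phase j th x))
    (cos (phase j th x) * (j.+1%:R / lam - rad x * cos th)).
  exact: (@is_derive_comp_fun _ (@sin R) (phase j ^~ x)).
have dM := is_deriveM_fun de ds (erefl _).
have dZ := is_deriveZ_fun (k := 2 * x * (x ^+ 2 - c ^+ 2) ^+ j) dM (erefl _).
apply: (is_derive_eq (df := wave_der j th x) dZ).
by rewrite /wave_der; ring.
Qed.

Lemma is_derive_wave_prim j th x : c < x ->
  is_derive x 1 (wave_prim j th) (wave_der j th x).
Proof.
move=> cx; set s := x ^+ 2 - c ^+ 2.
have s0 : 0 < s.
  by rewrite subr_gt0 ltr_pXn2r// nnegrE// (le_trans c0)// ltW.
have dq : is_derive x 1 (fun x => x ^+ 2 - c ^+ 2) (2 * x).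
  by apply: is_deriveB_fun; rewrite /GRing.scale/= ; ring.
have drad : is_derive x 1 rad (lam * s `^ (lam - 1) * (2 * x)).
  have H := is_derive_comp_fun (f := fun u => u `^ lam)
    (g := fun x => x ^+ 2 - c ^+ 2) (is_derive1_powR lam s0) dq (erefl _).
  apply: near_eq_is_derive H.
  near=> y; have cy : c < y by near: y; exact: lt_nbhsr.
  by rewrite /gap_powR ger0_norm// ltW// subr_gt0 ltr_pXn2r// nnegrE (le_trans c0)// ltW.
have rads : rad x = s * s `^ (lam - 1).
  by rewrite mulr_powRB1// ?ltW// /gap_powR -/s ger0_norm// ltW.
have dradM k : is_derive x 1 (fun x => rad x * k) (lam * s `^ (lam - 1) * (2 * x) * k).
  apply: is_derive_eq (is_deriveM_fun drad (is_derive_cst k _ _) (erefl _)) _.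
  by rewrite /cst/=; ring.
have de : is_derive x 1 (fun x => expR (- (rad x * cos th)))
    (- (lam * s `^ (lam - 1) * (2 * x) * cos th) * expR (- (rad x * cos th))).
  apply: is_derive_eq (is_derive_comp_fun (f := expR) (is_derive_expR _)
    (is_deriveN_fun (dradM (cos th)) (erefl _)) (erefl _)) _.
  by ring.
have dp : is_derive x 1 (phase j th) (- (lam * s `^ (lam - 1) * (2 * x) * sin th)).
  apply: is_derive_eq (is_deriveB_fun (is_derive_cst _ _ _) (dradM (sin th)) (erefl _)) _.
  by ring.
have dc : is_derive x 1 (fun x => cos (phase j th x))
    (lam * s `^ (lam - 1) * (2 * x) * sin th * sin (phase j th x)).
  apply: is_derive_eq (is_derive_comp_fun (f := @cos R) (is_derive_cos _) dp (erefl _)) _.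
  by ring.
have dX : is_derive x 1 (fun x => (x ^+ 2 - c ^+ 2) ^+ j.+1)
    (j.+1%:R * s ^+ j * (2 * x)).
  exact: is_deriveX_fun dq (erefl _).
have dZ := is_deriveZ_fun (k := lam^-1) dX (erefl _).
have dM := is_deriveM_fun de dc (erefl _).
have dV := is_deriveM_fun dZ dM (erefl _).
apply: (is_derive_eq (df := wave_der j th x) dV).
rewrite /wave_der -/s rads exprS.
have lam_neq0 : lam != 0 by rewrite gt_eqF.
by field.
Unshelve. all: by end_near. Qed.

Lemma continuous_gap_powR : continuous rad.
Proof.
move=> x; apply: (@continuous_comp _ _ _ (fun x => x ^+ 2 - c ^+ 2)
  (fun u : R => `|u| `^ lam)); last exact: continuous_normr_powR.
apply: (@continuousB _ _ _ (fun x : R => x ^+ 2)); last exact: cst_continuous.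
exact: exprn_continuous.
Qed.

Lemma continuous_gapX j : continuous (fun x => (x ^+ 2 - c ^+ 2) ^+ j).
Proof.
move=> x.
apply: (@continuous_comp _ _ _ (fun x : R => x ^+ 2 - c ^+ 2) (fun u : R => u ^+ j)).
  apply: (@continuousB _ _ _ (fun x : R => x ^+ 2)); last exact: cst_continuous.
  exact: exprn_continuous.
exact: exprn_continuous.
Qed.

Lemma continuous_wave_weight j : continuous (fun x => 2 * x * (x ^+ 2 - c ^+ 2) ^+ j).
Proof.
move=> x; apply: (@continuousM _ _ (fun x => 2 * x)); last exact: continuous_gapX.
by apply: continuousM; [exact: cst_continuous|exact: cvg_id].
Qed.

Lemma continuous_gap_powRM k : continuous (fun x => rad x * k).
Proof. by move=> x; apply: continuousM; [exact: continuous_gap_powR|exact: cst_continuous]. Qed.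

Lemma continuous_decay th : continuous (fun x => expR (- (rad x * cos th))).
Proof.
move=> x; apply: (@continuous_comp _ _ _ (fun x => - (rad x * cos th)) expR).
  by apply: continuousN; exact: continuous_gap_powRM.
exact: continuous_expR.
Qed.

Lemma continuous_phase j th : continuous (phase j th).
Proof.
move=> x; apply: (@continuousB _ _ _ (cst (j.+1%:R / lam * th)) (fun x => rad x * sin th)).
  exact: cst_continuous.
exact: continuous_gap_powRM.
Qed.

Lemma continuous_sin_phase j th : continuous (fun x => sin (phase j th x)).
Proof.
move=> x; apply: (@continuous_comp _ _ _ (phase j th) (@sin R)).
  exact: continuous_phase.
exact: continuous_sin.
Qed.

Lemma continuous_cos_phase j th : continuous (fun x => cos (phase j th x)).
Proof.
move=> x; apply: (@continuous_comp _ _ _ (phase j th) (@cos R)).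
  exact: continuous_phase.
exact: continuous_cos.
Qed.

Lemma continuous_wave j th : continuous (wave j th).
Proof.
move=> x; apply: (@continuousM _ _ (fun x => 2 * x * (x ^+ 2 - c ^+ 2) ^+ j)
  (fun x => expR (- (rad x * cos th)) * sin (phase j th x))).
  exact: continuous_wave_weight.
by apply: continuousM; [exact: continuous_decay|exact: continuous_sin_phase].
Qed.

Lemma continuous_wave_prim j th : continuous (wave_prim j th).
Proof.
move=> x; apply: (@continuousM _ _ (fun x => lam^-1 * (x ^+ 2 - c ^+ 2) ^+ j.+1)
  (fun x => expR (- (rad x * cos th)) * cos (phase j th x))).
  by apply: continuousM; [exact: cst_continuous|exact: continuous_gapX].
by apply: continuousM; [exact: continuous_decay|exact: continuous_cos_phase].
Qed.

Lemma continuous_wave_der j th : continuous (wave_der j th).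
Proof.
move=> x; apply: (@continuousM _ _ (fun x => 2 * x * (x ^+ 2 - c ^+ 2) ^+ j)
  (fun x => expR (- (rad x * cos th)) *
   (rad x * sin th * sin (phase j th x)
    + (j.+1%:R / lam - rad x * cos th) * cos (phase j th x)))).
  exact: continuous_wave_weight.
apply: continuousM; first exact: continuous_decay.
apply: (@continuousD _ _ _ (fun x => rad x * sin th * sin (phase j th x))).
  by apply: continuousM; [exact: continuous_gap_powRM|exact: continuous_sin_phase].
apply: continuousM; last exact: continuous_cos_phase.
apply: (@continuousB _ _ _ (cst (j.+1%:R / lam))); first exact: cst_continuous.
exact: continuous_gap_powRM.
Qed.

End rotation.

Section rotated_integral.
Context (R : realType) (c lam : R).
Hypotheses (c0 : 0 <= c) (lam0 : 0 < lam).
Notation mu := (@lebesgue_measure R).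
Notation rad := (gap_powR c lam).
Notation phase := (phase c lam).
Notation wave := (wave c lam).
Notation wave_prim := (wave_prim c lam).
Notation wave_der := (wave_der c lam).

Lemma wave_prim_left j th : wave_prim j th c = 0.
Proof. by rewrite /wave_prim/= subrr expr0n/= mulr0 mul0r. Qed.

Lemma integral_wave_der (j : nat) (th X : R) : c < X ->
  (\int[mu]_(x in `[c, X]) wave_der j th x)%R = wave_prim j th X.
Proof.
move=> cX; rewrite /Rintegral (continuous_FTC2 (F := wave_prim j th) cX).
- by rewrite wave_prim_left sube0.
- by apply: continuous_subspaceT; exact: continuous_wave_der.
- split.
  + move=> x /itvP xcX; have cx : c < x by rewrite xcX.
    by have [] := is_derive_wave_prim c0 lam0 j th cx.
  + exact/cvg_at_right_filter/continuous_wave_prim.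
  + exact/cvg_at_left_filter/continuous_wave_prim.
- move=> x /[!inE]/itvP xcX; have cx : c < x by rewrite xcX.
  have := is_derive_wave_prim c0 lam0 j th cx => dV.
  by rewrite derive1E derive_val.
Qed.

(** A bound uniform in the angle, as domination under the integral sign requires. *)
Lemma wave_der_bounded (j : nat) (th x X : R) : c <= x <= X ->
  `|wave_der j th x| <= 2 * X * (X ^+ 2 - c ^+ 2) ^+ j *
    (expR (rad X) * (rad X + (j.+1%:R / lam + rad X))).
Proof.
move=> /andP[cx xX]; have x0 : 0 <= x := le_trans c0 cx.
have X0 : 0 <= X := le_trans x0 xX.
have cXx : c ^+ 2 <= x ^+ 2 by rewrite ler_pXn2r// nnegrE.
have xXX : x ^+ 2 <= X ^+ 2 by rewrite ler_pXn2r// nnegrE.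
have r0 : 0 <= rad x by exact: powR_ge0.
have rX : rad x <= rad X.
  apply: ge0_ler_powR; rewrite ?nnegrE//; first exact: ltW.
  by rewrite !ger0_norm ?subr_ge0 ?lerB// (le_trans cXx).
have j0 : 0 <= j.+1%:R / lam by rewrite divr_ge0// ltW.
have ab1 (a b : R) : `|b| <= 1 -> `|a * b| <= `|a|.
  by move=> b1; rewrite normrM ler_piMr.
have sin1 a : `|sin a : R| <= 1.
  by rewrite ler_norml sin_geN1 sin_le1.
have cos1 a : `|cos a : R| <= 1.
  by rewrite ler_norml cos_geN1 cos_le1.
rewrite /wave_der normrM; apply: ler_pM => //.
  rewrite normrM !ger0_norm ?mulr_ge0 ?exprn_ge0 ?subr_ge0//.
  apply: ler_pM; rewrite ?mulr_ge0 ?exprn_ge0 ?subr_ge0//.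
    by rewrite ler_pM2l.
  apply: lerXn2r; rewrite ?nnegrE ?subr_ge0 ?lerB// (le_trans cXx)//.
rewrite normrM; apply: ler_pM => //.
  rewrite ger0_norm ?expR_ge0// ler_expR (le_trans _ rX)//.
  by rewrite (le_trans (ler_norm _))// normrN (le_trans (ab1 _ _ _))// ger0_norm.
rewrite (le_trans (ler_normD _ _))// lerD//.
  rewrite (le_trans (ab1 _ _ _))// (le_trans (ab1 _ _ _))//.
  by rewrite ger0_norm.
rewrite (le_trans (ab1 _ _ _))// (le_trans (ler_normB _ _))// lerD//.
  by rewrite ger0_norm.
by rewrite (le_trans (ab1 _ _ _))// ger0_norm.
Qed.

Lemma integrable_segment_continuous (f : R -> R) a b : continuous f ->
  mu.-integrable `[a, b] (EFin \o f).
Proof.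
move=> cf; apply: continuous_compact_integrable; first exact: segment_compact.
exact: continuous_subspaceT.
Qed.

(** Differentiation under the integral sign replaces [wave] by [wave_der], which is
    the derivative in [x] of [wave_prim], a function that vanishes at [c]. *)
Lemma is_derive_integral_wave (j : nat) (th X : R) : c < X ->
  is_derive th 1 (fun th => \int[mu]_(x in `[c, X]) wave j th x)%R
    (wave_prim j th X).
Proof.
move=> cX.
set M := 2 * X * (X ^+ 2 - c ^+ 2) ^+ j *
    (expR (rad X) * (rad X + (j.+1%:R / lam + rad X))).
have d1 a x : partial1of2 (wave j) a x = wave_der j a x.
  have dW := is_derive_wave_angle c lam j a x.
  by rewrite partial1of2E derive_val.
have Ia : `]th - 1, th + 1[%classic th by rewrite /= in_itv/=; lra.
have mI : measurable (`[c, X]%classic : set (measurableTypeR R)) by exact: measurable_itv.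
have intf (x : R) : `]th - 1, th + 1[%classic x -> mu.-integrable `[c, X] (EFin \o wave j x).
  by move=> _; apply: integrable_segment_continuous; exact: continuous_wave.
have derf (x y : R) : `]th - 1, th + 1[%classic x -> `[c, X]%classic y ->
    derivable (wave j ^~ y) x 1.
  by move=> _ _; have [] := is_derive_wave_angle c lam j x y.
have M0 : 0 <= M.
  apply: le_trans (wave_der_bounded j 0 (_ : c <= X <= X)); first by [].
  by rewrite lexx ltW.
have intG : mu.-integrable `[c, X] (EFin \o cst M).
  by apply: integrable_segment_continuous; exact: cst_continuous.
have Gub (x y : R) : `]th - 1, th + 1[%classic x -> `[c, X]%classic y ->
    `|partial1of2 (wave j) x y| <= cst M y.
  by move=> _; rewrite /= in_itv/= d1 => yX; exact: wave_der_bounded.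
have D := derivable_under_integral mI Ia intf derf (fun=> M0) intG Gub.
have E := differentiation_under_integral mI Ia intf derf (fun=> M0) intG Gub.
split; first exact: D.
rewrite -derive1E E -(integral_wave_der j th cX).
by apply: eq_Rintegral => x _; exact: d1.
Qed.

(** Mean value theorem in the angle: the integral vanishes at angle 0, where the
    phase is 0, and the cosine is smallest at [th0]. *)
Lemma le_integral_wave (j : nat) (th0 X : R) : c < X -> 0 < th0 -> th0 <= pi ->
  `|\int[mu]_(x in `[c, X]) wave j th0 x| <=
    th0 * (lam^-1 * (X ^+ 2 - c ^+ 2) ^+ j.+1 * expR (- (rad X * cos th0))).
Proof.
move=> cX th00 th0pi.
set F := fun th => (\int[mu]_(x in `[c, X]) wave j th x)%R.
have dF (th : R) : is_derive th 1 F (wave_prim j th X) by exact: is_derive_integral_wave.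
have cF : {within `[0, th0], continuous F}.
  by apply: derivable_within_continuous => th _; have [] := dF th.
have [xi /itvP xi0] := MVT th00 (fun th _ => dF th) cF.
have F0 : F 0 = 0.
  rewrite /F (_ : wave j 0 = cst 0); last first.
    by apply/funext => x; rewrite /wave /phase mulr0 sin0 mulr0 subrr sin0 !mulr0.
  by rewrite /Rintegral/= integral0.
rewrite F0 !subr0 => E.
rewrite -[X in `|X|]/(F th0) E normrM (gtr0_norm th00) mulrC ler_pM2l//.
have q0 : 0 <= X ^+ 2 - c ^+ 2.
  by rewrite subr_ge0 ler_pXn2r ?nnegrE ?(ltW cX)// (le_trans c0)// ltW.
rewrite /wave_prim normrM ger0_norm; last first.
  by rewrite mulr_ge0 ?exprn_ge0// invr_ge0 ltW.
rewrite ler_wpM2l//; first by rewrite mulr_ge0 ?exprn_ge0// invr_ge0 ltW.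
rewrite normrM ger0_norm ?expR_ge0// -[leRHS]mulr1 ler_pM ?expR_ge0//.
  rewrite ler_expR lerN2 ler_wpM2l ?powR_ge0//.
  by rewrite ltW// ltr_cos ?in_itv/= ?xi0 ?(ltW th00) ?th0pi// (le_trans _ th0pi) ?xi0.
by rewrite ler_norml cos_geN1 cos_le1.
Qed.

End rotated_integral.

(** * A function on a half-line without odd moments *)

Lemma sinB_natpi (R : realType) (n : nat) (y : R) :
  sin (n%:R * pi - y) = - (-1) ^+ n * sin y.
Proof.
elim: n => [|n IH]; first by rewrite mul0r sub0r sinN expr0 mulN1r.
by rewrite mulrSr mulrDl mul1r addrAC sinDpi IH exprS; ring.
Qed.

Section half_line.
Context (R : realType) (c lam : R).
Hypotheses (c1 : 1 <= c) (lam0 : 0 < lam) (lam12 : lam < 2^-1).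
Notation mu := (@lebesgue_measure R).
Notation rad := (gap_powR c lam).
Notation a := (cos (pi * lam)).
Notation b := (sin (pi * lam)).

(** The constant [c `^ (2 * lam)] is there for [bump_bound]: the gap to [c] vanishes
    at [x = c], while the bound is in terms of [x]. *)
Definition bump (x : R) : R :=
  expR (- (a * (rad x + c `^ (2 * lam)))) * sin (b * rad x).

Let c0 : 0 <= c. Proof. exact: le_trans c1. Qed.

Let pilam : 0 < pi * lam < pi / 2.
Proof. by rewrite mulr_gt0 ?pi_gt0//= ltr_pM2l// pi_gt0. Qed.

Lemma cos_pilam_gt0 : 0 < a.
Proof.
case/andP: pilam => p0 p2; apply: cos_gt0_pihalf; rewrite p2 andbT.
by rewrite (lt_trans _ p0)// oppr_lt0 divr_gt0 ?pi_gt0.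
Qed.

Lemma sin_pilam_gt0 : 0 < b.
Proof. exact: sin_gt0_pihalf pilam. Qed.

Lemma bumpN x : bump (- x) = bump x.
Proof. by rewrite /bump /gap_powR sqrrN. Qed.

(** Subadditivity of the power [lam]: [x ^ (2 * lam)] is at most the sum of
    [(x ^ 2 - c ^ 2) ^ lam] and [c ^ (2 * lam)]. *)
Lemma bump_bound x : c <= x -> `|bump x| <= expR (- (a * x `^ (2 * lam))).
Proof.
move=> cx; have x0 : 0 <= x := le_trans c0 cx.
rewrite /bump normrM ger0_norm ?expR_ge0// -[leRHS]mulr1 ler_pM ?expR_ge0//.
  rewrite ler_expR lerN2 ler_pM2l ?cos_pilam_gt0//.
  have sq (y : R) : 0 <= y -> y `^ (2 * lam) = (y ^+ 2) `^ lam.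
    by move=> y0; rewrite powRrM powR_mulrn.
  rewrite !sq// -[X in X `^ lam <= _](subrK (c ^+ 2)) /gap_powR.
  have q0 : 0 <= x ^+ 2 - c ^+ 2 by rewrite subr_ge0 ler_pXn2r ?nnegrE.
  rewrite (ger0_norm q0); apply: powR_subadd; rewrite ?exprn_ge0//.
  by rewrite lam0 (le_trans (ltW lam12))// invf_le1// ler1n.
by rewrite ler_norml sin_geN1 sin_le1.
Qed.

Lemma continuous_bump : continuous bump.
Proof.
move=> x; apply: (@continuousM _ _ (fun x => expR (- (a * (rad x + c `^ (2 * lam)))))
  (fun x => sin (b * rad x))).
  apply: (@continuous_comp _ _ _ (fun x => - (a * (rad x + c `^ (2 * lam)))) expR);
    last exact: continuous_expR.
  apply: continuousN; apply: continuousM; first exact: cst_continuous.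
  by apply: continuousD; [exact: continuous_gap_powR|exact: cst_continuous].
apply: (@continuous_comp _ _ _ (fun x => b * rad x) (@sin R));
  last exact: continuous_sin.
by apply: continuousM; [exact: cst_continuous|exact: continuous_gap_powR].
Qed.

Lemma continuous_bump_moment (k : nat) : continuous (fun x : R => x ^+ k * bump x).
Proof.
move=> x; apply: (@continuousM _ _ (fun x : R => x ^+ k)).
  exact: exprn_continuous.
exact: continuous_bump.
Qed.

Lemma integrable_oneDsqrV : mu.-integrable `[c, +oo[ (EFin \o (fun x => (oneDsqr x)^-1)).
Proof.
have m : measurable_fun setT (fun x : R => (oneDsqr x)^-1).
  by apply: continuous_measurable_fun; exact: continuous_oneDsqrV.
apply: (@integrableS _ _ _ mu `[0, +oo[) => //.
  by apply: subset_itvr; rewrite bnd_simp.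
apply/integrableP; split; first by apply/measurable_EFinP/measurable_funTS.
rewrite [ltLHS](_ : _ = (pi / 2)%:E) ?ltry// -integral0y_oneDsqr.
by apply: eq_integral => x _ /=; rewrite ger0_norm// invr_ge0.
Qed.

Lemma integrable_bump_moment (k : nat) :
  mu.-integrable `[c, +oo[ (EFin \o (fun x : R => x ^+ k * bump x)).
Proof.
have lam20 : 0 < 2 * lam by rewrite mulr_gt0.
have [C C0 HC] := powR_expR_bounded k.+2%:R cos_pilam_gt0 lam20.
have iG : mu.-integrable `[c, +oo[ (EFin \o (fun x => 2 * C * (oneDsqr x)^-1)).
  exact: (integrableZl _ (2 * C) integrable_oneDsqrV).
apply: le_integrable iG => //.
  by apply/measurable_EFinP/measurable_funTS; apply: continuous_measurable_fun;
    exact: continuous_bump_moment.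
move=> x; rewrite /= in_itv/= andbT => cx; rewrite lee_fin.
have x1 : 1 <= x := le_trans c1 cx.
have x0 : 0 < x := lt_le_trans ltr01 x1.
rewrite [leRHS]ger0_norm; last by rewrite !mulr_ge0 ?(ltW C0).
rewrite normrM ger0_norm ?exprn_ge0 ?(ltW x0)//.
rewrite ler_pdivlMr ?oneDsqr_gt0//.
have x21 : oneDsqr x <= 2 * x ^+ 2.
  by rewrite /oneDsqr/= mulr_natl mulr2n lerD2r expr_ge1 ?(ltW x0).
apply: (@le_trans _ _ (x ^+ k * expR (- (a * x `^ (2 * lam))) * (2 * x ^+ 2))).
  apply: ler_pM => //; first by rewrite mulr_ge0 ?exprn_ge0 ?(ltW x0).
  by rewrite ler_wpM2l ?exprn_ge0 ?(ltW x0)// bump_bound.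
have := HC _ x1; rewrite powR_mulrn ?(ltW x0)// => H.
rewrite [leLHS](_ : _ = 2 * (x ^+ k.+2 * expR (- (a * x `^ (2 * lam))))).
  by rewrite ler_pM2l.
by rewrite !exprS expr0; ring.
Qed.

(** At the angle [pi * lam] the phase is [(j + 1) * pi - b * t], so the multiple of
    [pi] contributes only a sign. *)
Lemma wave_pilam (j : nat) (x : R) : wave c lam j (pi * lam) x =
  (2 * (- (-1) ^+ j.+1 * expR (a * c `^ (2 * lam)))) *
  (x * (x ^+ 2 - c ^+ 2) ^+ j * bump x).
Proof.
have ph : phase c lam j (pi * lam) x = j.+1%:R * pi - b * rad x.
  rewrite /phase [b * _]mulrC; congr (_ - _).
  by rewrite -mulrA; congr (_ * _); rewrite mulrCA mulVf ?mulr1// gt_eqF.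
rewrite /wave ph sinB_natpi /bump [X in expR (- X)]mulrC.
rewrite [a * (_ + _)]mulrDr opprD expRD [expR (- (a * c `^ _))]expRN.
have e0 : expR (a * c `^ (2 * lam)) != 0 by rewrite gt_eqF// expR_gt0.
by field.
Qed.

End half_line.

Lemma cvg_integral_segment (R : realType) (c : R) (f : R -> R) :
  lebesgue_measure.-integrable `[c, +oo[ (EFin \o f) ->
  (\int[lebesgue_measure]_(x in `[c, (c + n%:R)%R]) (f x)%:E)%E @[n --> \oo] -->
  (\int[lebesgue_measure]_(x in `[c, +oo[) (f x)%:E)%E.
Proof.
move=> intf.
pose f_ n : R -> \bar R := (EFin \o f) \_ `[c, c + n%:R].
have mD : measurable (`[c, +oo[%classic : set (measurableTypeR R)) by [].
have mf : measurable_fun (`[c, +oo[%classic : set (measurableTypeR R)) (EFin \o f).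
  exact: measurable_int intf.
have [|||||_ _] := @dominated_convergence _ _ _ lebesgue_measure _ mD f_
    (EFin \o f) (abse \o (EFin \o f)).
- move=> n; apply/measurable_restrict => //.
  by apply: measurable_funS mf => //; exact: subIsetl.
- by [].
- apply/aeW => x /=; rewrite in_itv/= andbT => cx.
  apply: cvg_near_cst; near=> n.
  rewrite /f_ patchE ifT//; apply/mem_set; rewrite /= in_itv/= cx/=.
  by rewrite -lerBlDl; near: n; exact: nbhs_infty_ger.
- exact: integrable_abse.
- apply/aeW => x /= n cx; rewrite /f_ patchE.
  by case: ifPn => // _; rewrite abse0.
rewrite (_ : [sequence _]_n =
  (fun n => \int[lebesgue_measure]_(x in `[c, (c + n%:R)%R]) (f x)%:E)%E)//.
apply/funext => n /=; rewrite -integral_mkcondr; congr (integral _ _ _).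
by apply/seteqP; split => x /=; rewrite !in_itv/= andbT; [case|move=> /andP[-> ->]].
Unshelve. all: by end_near. Qed.

Section half_line_moments.
Context (R : realType) (c lam : R).
Hypotheses (c1 : 1 <= c) (lam0 : 0 < lam) (lam12 : lam < 2^-1).
Notation mu := (@lebesgue_measure R).
Notation rad := (gap_powR c lam).
Notation bump := (bump c lam).
Notation a := (cos (pi * lam)).

Let c0 : 0 <= c. Proof. exact: le_trans c1. Qed.

Lemma integrable_gap_bump (m j : nat) :
  mu.-integrable `[c, +oo[ (EFin \o (fun x : R => x ^+ m * (x ^+ 2 - c ^+ 2) ^+ j * bump x)).
Proof.
apply: le_integrable (integrable_bump_moment c1 lam0 lam12 (m + 2 * j)) => //.
  apply/measurable_EFinP/measurable_funTS; apply: continuous_measurable_fun => x.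
  apply: (@continuousM _ _ (fun x : R => x ^+ m * (x ^+ 2 - c ^+ 2) ^+ j)).
    apply: (@continuousM _ _ (fun x : R => x ^+ m)); first exact: exprn_continuous.
    exact: continuous_gapX.
  exact: continuous_bump.
move=> x; rewrite /= in_itv/= andbT lee_fin => cx.
have x0 : 0 <= x := le_trans c0 cx.
have q0 : 0 <= x ^+ 2 - c ^+ 2 by rewrite subr_ge0 ler_pXn2r ?nnegrE.
rewrite exprD exprM !normrM !(ger0_norm (exprn_ge0 _ x0)) (ger0_norm (exprn_ge0 _ q0)).
rewrite (ger0_norm (exprn_ge0 _ (exprn_ge0 2 x0))) ler_wpM2r// ler_wpM2l ?exprn_ge0//.
by rewrite lerXn2r ?nnegrE ?exprn_ge0// lerBlDr lerDl exprn_ge0.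
Qed.

(** By [wave_pilam] this is a multiple of the limit of the rotated integrals, and
    [le_integral_wave] bounds those by a constant times
    [u ^ (j + 1) * exp (- a * u ^ lam)] at [u = X ^ 2 - c ^ 2], hence by a constant
    times [1 / u]. *)
Lemma integral_gap_bump (j : nat) :
  (\int[mu]_(x in `[c, +oo[) (x * (x ^+ 2 - c ^+ 2) ^+ j * bump x)%:E = 0)%E.
Proof.
set f := fun x : R => x * (x ^+ 2 - c ^+ 2) ^+ j * bump x.
have intf : mu.-integrable `[c, +oo[ (EFin \o f) by exact: (integrable_gap_bump 1 j).
have cvgf := cvg_integral_segment intf.
set K := 2 * (- (-1) ^+ j.+1 * expR (a * c `^ (2 * lam))) : R.
have K0 : K != 0.
  by rewrite !mulf_eq0 pnatr_eq0 oppr_eq0 signr_eq0 (gt_eqF (expR_gt0 _)).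
have a0 : 0 < a by exact: cos_pilam_gt0.
have [C C0 HC] := powR_expR_bounded j.+2%:R a0 lam0.
set M := pi * lam * lam^-1 * C / `|K|.
have fK n : (\int[mu]_(x in `[c, (c + n%:R)%R]) f x)%R =
    K^-1 * (\int[mu]_(x in `[c, (c + n%:R)%R]) wave c lam j (pi * lam) x)%R.
  rewrite -RintegralZl//; last first.
    by apply: integrable_segment_continuous; exact: continuous_wave.
  by apply: eq_Rintegral => x _; rewrite wave_pilam// -/K mulrA (mulVf K0) mul1r.
have le n : `|(\int[mu]_(x in `[c, (c + n.+1%:R)%R]) f x)%R| <= M * harmonic n.
  have cX : c < c + n.+1%:R by rewrite ltrDl.
  have p0 : 0 < pi * lam by rewrite mulr_gt0 ?pi_gt0.
  have ppi : pi * lam <= pi.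
    by rewrite ger_pMr ?pi_gt0// (le_trans (ltW lam12))// invf_le1// ler1n.
  have := le_integral_wave c0 lam0 j cX p0 ppi.
  set X := c + n.+1%:R.
  have qn : n.+1%:R <= X ^+ 2 - c ^+ 2.
    have n1 : 1 <= n.+1%:R :> R by rewrite ler1n.
    rewrite /X; move: n1; move: (n.+1%:R : R) => N N1.
    rewrite [leRHS](_ : _ = N * (2 * c + N)); last by ring.
    rewrite ler_peMr// ?(le_trans ler01 N1)//.
    by rewrite (le_trans N1)// lerDr mulr_ge0.
  have q1 : 1 <= X ^+ 2 - c ^+ 2 by rewrite (le_trans _ qn)// ler1n.
  have q0 : 0 < X ^+ 2 - c ^+ 2 by rewrite (lt_le_trans _ q1).
  move=> H; rewrite fK normrM normfV mulrC ler_pdivrMr ?normr_gt0//.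
  apply: le_trans H _; rewrite /M -!mulrA ler_wpM2l ?pi_ge0// ler_wpM2l ?(ltW lam0)//.
  rewrite ler_wpM2l ?invr_ge0 ?(ltW lam0)//.
  rewrite [leRHS](_ : _ = C * n.+1%:R^-1); last first.
    have K1 : `|K| != 0 by rewrite normr_eq0.
    by rewrite /harmonic/= [_^-1 * `|K|]mulrC mulKf.
  rewrite ler_pdivlMr ?ltr0n//.
  have := HC _ q1; rewrite powR_mulrn ?(ltW q0)// => HCq.
  apply: le_trans HCq.
  rewrite /gap_powR ger0_norm ?(ltW q0)// [cos _ * _]mulrC mulrAC.
  by rewrite ler_wpM2r ?expR_ge0// [leRHS]exprSr ler_wpM2l// exprn_ge0// ltW.
have cvg0 : (\int[mu]_(x in `[c, (c + n.+1%:R)%R]) f x)%R @[n --> \oo] --> (0 : R).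
  apply: norm_cvg0; apply: (@squeeze_cvgr _ _ _ _ (cst 0) (fun n => M * harmonic n)).
  - by apply: nearW => n /=; rewrite normr_ge0 le.
  - exact: cvg_cst.
  - rewrite -[X in _ --> X](mulr0 M).
    by apply: cvgM; [exact: cvg_cst|exact: cvg_harmonic].
have cvgf1 : (\int[mu]_(x in `[c, (c + n.+1%:R)%R]) (f x)%:E)%E @[n --> \oo] -->
    (\int[mu]_(x in `[c, +oo[) (f x)%:E)%E.
  rewrite (_ : (fun n => _) =
      [sequence (\int[mu]_(x in `[c, (c + n%:R)%R]) (f x)%:E)%E]_n \o S)//.
  by apply: cvg_comp cvgf; exact: cvg_addnl 1.
apply: (cvg_unique _ cvgf1) => //.
apply: cvg_EFin; last exact: cvg0.
apply: nearW => n; rewrite integrable_fin_num//.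
by apply: integrableS intf => //; apply: subset_itvl; rewrite bnd_simp.
Qed.

(** Induction on the power of [x], from [x ^ 2 = (x ^ 2 - c ^ 2) + c ^ 2]. *)
Lemma integral_odd_gap_bump (m j : nat) :
  (\int[mu]_(x in `[c, +oo[) (x ^+ m.*2.+1 * (x ^+ 2 - c ^+ 2) ^+ j * bump x)%:E = 0)%E.
Proof.
elim: m j => [|m IH] j; first exact: integral_gap_bump.
have E x : (x ^+ m.+1.*2.+1 * (x ^+ 2 - c ^+ 2) ^+ j * bump x)%:E =
    ((x ^+ m.*2.+1 * (x ^+ 2 - c ^+ 2) ^+ j.+1 * bump x)%:E +
    (c ^+ 2)%:E * (x ^+ m.*2.+1 * (x ^+ 2 - c ^+ 2) ^+ j * bump x)%:E)%E.
  by rewrite -EFinM -EFinD; congr EFin; rewrite doubleS !exprS; ring.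
under eq_integral do rewrite E.
have mD : measurable (`[c, +oo[%classic : set (measurableTypeR R)) by [].
rewrite integralD//=; last 2 first.
- exact: (integrable_gap_bump m.*2.+1 j.+1).
- exact: (integrableZl _ (c ^+ 2) (integrable_gap_bump m.*2.+1 j)).
rewrite IH add0e integralZl//; last exact: (integrable_gap_bump m.*2.+1 j).
by rewrite IH mule0.
Qed.

Lemma integral_odd_bump (k : nat) : odd k ->
  (\int[mu]_(x in `[c, +oo[) (x ^+ k * bump x)%:E = 0)%E.
Proof.
move=> oddk; rewrite -(odd_double_half k) oddk add1n.
have := integral_odd_gap_bump k./2 0.
by under eq_integral do rewrite expr0 mulr1.
Qed.

End half_line_moments.

(** * An odd function all of whose moments vanish *)

Section perturbation.
Context (R : realType) (c lam : R).
Hypotheses (c1 : 1 <= c) (lam0 : 0 < lam) (lam12 : lam < 2^-1).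
Notation mu := (@lebesgue_measure R).
Notation bump := (bump c lam).
Notation a := (cos (pi * lam)).

Definition odd_bump (x : R) : R := (bump \_ `[c, +oo[) x - (bump \_ `]-oo, - c]) x.

Let c0 : 0 < c. Proof. exact: lt_le_trans c1. Qed.

Let mr : measurable (`[c, +oo[%classic : set (measurableTypeR R)). Proof. by []. Qed.
Let ml : measurable (`]-oo, - c]%classic : set (measurableTypeR R)). Proof. by []. Qed.

Lemma odd_bump_right x : c <= x -> odd_bump x = bump x.
Proof.
move=> cx; rewrite /odd_bump !patchE mem_set/=; last by rewrite in_itv/= cx.
rewrite memNset ?subr0//= in_itv/=; apply/negP; rewrite -ltNge.
by rewrite (lt_le_trans _ cx)// gtrN.
Qed.

Lemma odd_bump_left x : x <= - c -> odd_bump x = - bump x.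
Proof.
move=> cx; rewrite /odd_bump !patchE (@mem_set _ `]-oo, - c])/=; last by rewrite in_itv/= cx.
rewrite memNset ?sub0r//= in_itv/= andbT; apply/negP; rewrite -ltNge.
by rewrite (le_lt_trans cx)// gtrN.
Qed.

Lemma odd_bump0 x : `|x| < c -> odd_bump x = 0.
Proof.
rewrite ltr_norml => /andP[cx xc].
rewrite /odd_bump !patchE !memNset ?subrr//= in_itv/= ?andbT.
  by apply/negP; rewrite -ltNge.
by apply/negP; rewrite -ltNge.
Qed.

Lemma odd_bump_bound x y : 0 <= y -> y <= `|x| ->
  `|odd_bump x| <= expR (- (a * y `^ (2 * lam))).
Proof.
move=> y0 yx; have a0 : 0 < a by exact: cos_pilam_gt0.
have le z : c <= z -> y <= z -> `|bump z| <= expR (- (a * y `^ (2 * lam))).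
  move=> cz yz; rewrite (le_trans (bump_bound c1 lam0 lam12 cz))//.
  rewrite ler_expR lerN2 ler_pM2l// ge0_ler_powR ?nnegrE//.
    by rewrite mulr_ge0// ltW.
  by rewrite (le_trans y0).
have [xc|] := ltP `|x| c; first by rewrite odd_bump0// normr0 expR_ge0.
rewrite ler_normr => /orP[cx|cx].
  have x0 : 0 <= x by rewrite (le_trans _ cx)// ltW.
  by rewrite odd_bump_right// le// -(ger0_norm x0).
have xc : x <= - c by rewrite lerNr.
have x0 : x <= 0 by rewrite (le_trans xc)// oppr_le0 ltW.
by rewrite odd_bump_left// normrN -bumpN le// -(ler0_norm x0).
Qed.

Let moment (k : nat) (x : R) : R := x ^+ k * bump x.

Let momentN k x : moment k (- x) = (-1) ^+ k * moment k x.
Proof. by rewrite /moment bumpN [in LHS]exprNn -mulrA. Qed.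

Let measurable_moment k : measurable_fun setT (moment k).
Proof. by apply: continuous_measurable_fun; exact: continuous_bump_moment. Qed.

Let preimage_left : -%R @^-1` `]-oo, - c] = (`[c, +oo[%classic : set R).
Proof. by apply/seteqP; split => x /=; rewrite !in_itv/= andbT lerN2. Qed.

Let integrable_moment_opp k :
  mu.-integrable (-%R @^-1` `]-oo, - c]) ((EFin \o moment k) \o -%R).
Proof.
rewrite preimage_left.
have := integrableZl mr ((-1) ^+ k) (integrable_bump_moment c1 lam0 lam12 k).
by apply: eq_integrable => // x _ /=; rewrite -EFinM -momentN.
Qed.

Let measurable_opp :
  measurable_fun setT (-%R : measurableTypeR R -> measurableTypeR R).
Proof. exact: oppr_measurable. Qed.

Lemma integrable_left_moment (k : nat) : mu.-integrable `]-oo, - c] (EFin \o moment k).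
Proof.
have mk : measurable_fun setT (EFin \o moment k) by exact/measurable_EFinP.
have /integrableP[_ intN] := integrable_pushforward measurable_opp mk (integrable_moment_opp k) ml.
apply/integrableP; split; first exact: measurable_funTS.
apply: le_lt_trans intN; rewrite le_eqVlt; apply/orP; left; apply/eqP.
apply: eq_measure_integral => A mA _; exact/esym/lebesgue_measureN.
Qed.

Lemma integral_left_moment (k : nat) :
  (\int[mu]_(x in `]-oo, (- c)%R]) (moment k x)%:E =
   ((-1) ^+ k)%:E * \int[mu]_(x in `[c, +oo[) (moment k x)%:E)%E.
Proof.
have mk : measurable_fun setT (EFin \o moment k) by exact/measurable_EFinP.
rewrite -integralZl//; last exact: (integrable_bump_moment c1 lam0 lam12 k).
transitivity (\int[pushforward mu (-%R : measurableTypeR R -> measurableTypeR R)]_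
    (x in `]-oo, (- c)%R]) (moment k x)%:E)%E.
  by apply: eq_measure_integral => A mA _; exact/esym/lebesgue_measureN.
rewrite (integral_pushforward measurable_opp mk (integrable_moment_opp k) ml) preimage_left.
by apply: eq_integral => x _ /=; rewrite momentN EFinM.
Qed.

Lemma odd_bump_momentE k (x : R) : x ^+ k * odd_bump x =
  (moment k \_ `[c, +oo[) x - (moment k \_ `]-oo, - c]) x.
Proof. by rewrite /odd_bump !patchE mulrBr; do 2 case: ifP; rewrite ?mulr0. Qed.

Lemma integrable_right_patch k : mu.-integrable setT (EFin \o (moment k \_ `[c, +oo[)).
Proof.
rewrite -restrict_EFin; apply/(integrable_mkcond _ mr).
exact: (integrable_bump_moment c1 lam0 lam12 k).
Qed.

Lemma integrable_left_patch k : mu.-integrable setT (EFin \o (moment k \_ `]-oo, - c])).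
Proof.
by rewrite -restrict_EFin; apply/(integrable_mkcond _ ml); exact: integrable_left_moment.
Qed.

Lemma integrable_odd_bump (k : nat) :
  mu.-integrable setT (EFin \o (fun x => x ^+ k * odd_bump x)).
Proof.
apply: eq_integrable (integrableB _ (integrable_right_patch k) (integrable_left_patch k)) => //.
by move=> x _; rewrite /= odd_bump_momentE EFinB.
Qed.

(** The two half-lines cancel when [k] is even; when [k] is odd each of them
    contributes zero. *)
Lemma integral_odd_bump0 (k : nat) : (\int[mu]_x (x ^+ k * odd_bump x)%:E = 0)%E.
Proof.
under eq_integral do rewrite odd_bump_momentE EFinB.
rewrite integralB//; [|exact: integrable_right_patch|exact: integrable_left_patch].
under eq_integral do rewrite -[(_ \_ _ _)%:E]/((EFin \o (_ \_ _)) _) -restrict_EFin.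
under [X in (_ - X)%E]eq_integral do
  rewrite -[(_ \_ _ _)%:E]/((EFin \o (_ \_ _)) _) -restrict_EFin.
rewrite -!integral_mkcond integral_left_moment.
have [oddk|evenk] := boolP (odd k).
  by rewrite integral_odd_bump// mule0 sube0.
rewrite -signr_odd (negbTE evenk) expr0 mul1e subee//.
by apply: integrable_fin_num => //; exact: (integrable_bump_moment c1 lam0 lam12 k).
Qed.

Lemma measurable_odd_bump : measurable_fun setT odd_bump.
Proof.
have /integrableP[/measurable_EFinP + _] := integrable_odd_bump 0.
by under eq_fun do rewrite expr0 mul1r.
Qed.

(** Just to the right of [c] the argument of the sine lies between 0 and [pi]. *)
Lemma odd_bump_neq0 : exists2 A : set (measurableTypeR R),
  measurable A & (\int[mu]_(x in A) (odd_bump x)%:E != 0)%E.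
Proof.
(* this width gives (c + e)^2 - c^2 <= 2/3 + 1/9, hence a gap of at most 1 *)
pose e : R := (3 * c)^-1.
have e0 : 0 < e by rewrite invr_gt0 mulr_gt0.
have ec : e * c = 3^-1.
  by rewrite /e invfM mulfVK// gt_eqF.
have e3 : e <= 3^-1 by rewrite -ec ler_peMr// ltW.
exists `]c, c + e]%classic; first by [].
have pos x : x \in (`]c, c + e]%classic : set R) -> 0 < odd_bump x.
  rewrite inE/= in_itv/= => /andP[cx xe]; rewrite odd_bump_right ?ltW//.
  rewrite mulr_gt0 ?expR_gt0//; apply: sin_gt0_pi.
  have b0 : 0 < sin (pi * lam) by exact: sin_pilam_gt0.
  have q0 : 0 < x ^+ 2 - c ^+ 2.
    by rewrite subr_gt0 ltr_pXn2r// nnegrE ltW// (lt_trans c0).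
  have q1 : x ^+ 2 - c ^+ 2 <= 1.
    have x0 : 0 <= x by rewrite ltW// (lt_trans c0).
    have : x ^+ 2 <= (c + e) ^+ 2 by rewrite ler_pXn2r// nnegrE (le_trans x0).
    rewrite lerBlDr => /le_trans; apply.
    have -> : (c + e) ^+ 2 = 2 * (e * c) + e ^+ 2 + c ^+ 2 by ring.
    rewrite lerD2r ec.
    have : e ^+ 2 <= 3^-1 ^+ 2 by rewrite !expr2 ler_pM// (ltW e0).
    by lra.
  have r0 : 0 < gap_powR c lam x by rewrite powR_gt0// normr_gt0 gt_eqF.
  have r1 : gap_powR c lam x <= 1.
    have := @ge0_ler_powR _ lam (ltW lam0) _ 1 _ _ q1.
    rewrite powR1 /gap_powR (ger0_norm (ltW q0)); apply; rewrite nnegrE//.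
    exact: ltW.
  rewrite mulr_gt0//= (le_lt_trans (y := 1))//.
    by rewrite mulr_ile1 ?sin_le1// ltW.
  by rewrite (lt_le_trans _ (pi_ge2 R))// ltr1n.
apply/eqP => I0; set A := (`]c, c + e]%classic : set (measurableTypeR R)).
have mA : measurable A by exact: measurable_itv.
have mf : measurable_fun A (EFin \o odd_bump).
  by apply/measurable_EFinP/measurable_funTS; exact: measurable_odd_bump.
have : (\int[mu]_(x in A) `|(EFin \o odd_bump) x| = 0)%E.
  rewrite -[RHS]I0; apply: eq_integral => x xA /=.
  by rewrite gtr0_norm// pos.
move/(ae_eq_integral_abs mu mA mf) => [N [mN N0 AN]].
have : (mu A <= mu N)%E.
  apply: le_measure; rewrite ?inE//; apply: subset_trans AN => x Ax /= /(_ Ax) [].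
  by apply/eqP; rewrite gt_eqF// pos// inE.
rewrite N0 /A lebesgue_measure_itv/= lte_fin ltrDl e0 -EFinB lee_fin.
by rewrite addrAC subrr add0r leNgt e0.
Qed.

End perturbation.

(** * Independence and the law of a product *)

Section others_product.
Context d (T : measurableType d) (R : realType) (P : probability T R).
Context (I : finType) (X : I -> {RV P >-> R}) (j : I).

Definition others_product (w : T) : R := \prod_(i | i != j) X i w.

Let measurable_others_product : measurable_fun setT others_product.
Proof.
rewrite /others_product; under eq_fun do rewrite -big_filter.
by apply: measurable_prod => i _; exact: measurable_funPT.
Qed.

HB.instance Definition _ := isMeasurableFun.Build _ _ _ _ others_product
  measurable_others_product.

End others_product.

Section independence.
Context d (T : measurableType d) (R : realType) (P : probability T R).

(** The events [E] that are independent of the event [X j \in A] are those on which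
    two finite measures agree.  They agree on the finite intersections of events on
    the other variables, a class stable under intersection, hence on the
    sigma-algebra it generates, for which the product of the others is measurable. *)
Lemma mutually_independent_prod_others (I : finType) (X : I -> {RV P >-> R}) (j : I)
    (A B : set R) : mutually_independent P X -> measurable A -> measurable B ->
  (P (X j @^-1` A `&` others_product X j @^-1` B) =
   P (X j @^-1` A) * P (others_product X j @^-1` B))%E.
Proof.
move=> indX mA mB; set Y : T -> R := others_product X j.
pose G : set (set T) := [set E | exists2 F : I -> set R,
  (forall i, measurable (F i)) & E = \bigcap_(i in [set i | i != j]) X i @^-1` F i].
have mX i F : measurable F -> measurable (X i @^-1` F).
  by move=> mF; rewrite -[X in measurable X]setTI; exact: measurable_funPT.
have Gm : G `<=` measurable.
  move=> _ [F mF ->]; apply: fin_bigcap_measurable => [|i _]; first exact: finite_finset.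
  exact: mX.
have GT : G setT.
  exists (fun=> setT); first by move=> i; exact: measurableT.
  by apply/esym/seteqP; split.
have GI : setI_closed G.
  move=> _ _ [F1 mF1 ->] [F2 mF2 ->]; exists (fun i => F1 i `&` F2 i).
    by move=> i; exact: measurableI.
  apply/seteqP; split => [w [w1 w2] i ij|w w12].
    by split; [exact: w1|exact: w2].
  by split => i ij; have [] := w12 i ij.
have mXA : measurable (X j @^-1` A) by exact: mX.
have GX i F : i != j -> measurable F -> G (X i @^-1` F).
  move=> ij mF; exists (fun k => if k == i then F else setT).
    by move=> k; case: ifP => // _; exact: measurableT.
  apply/seteqP; split => [w wF k kj /=|w /(_ i ij)/=]; last by rewrite eqxx.
  by case: eqP => // ->.
have mY : <<s G >> (Y @^-1` B).
  have mYG : measurable_fun [set: g_sigma_algebraType G] (Y : g_sigma_algebraType G -> R).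
    rewrite /Y /others_product; under eq_fun do rewrite -big_filter.
    apply: measurable_prod => i; rewrite mem_filter => /andP[ij _] _ F mF.
    by rewrite setTI; apply: sub_sigma_algebra; exact: GX.
  by have := mYG measurableT _ mB; rewrite setTI.
have nn : 0 <= fine (P (X j @^-1` A)) by rewrite fine_ge0.
pose m2 := mscale (NngNum nn) P.
have eqG E : G E -> mrestr P mXA E = m2 E.
  move=> [F mF ->{E}]; rewrite /mrestr /m2 /mscale/= fineK ?fin_num_measure//.
  pose F' i := if i == j then A else F i.
  have mF' i : measurable (F' i) by rewrite /F'; case: ifP.
  have := indX [set: I]%SET F' mF'; have := indX [set~ j]%SET F' mF'.
  have -> : \bigcap_(i in [set i | i \in [set: I]%SET]) X i @^-1` F' i =
      \bigcap_(i in [set i | i != j]) X i @^-1` F i `&` X j @^-1` A.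
    apply/seteqP; split => [w wF|w [wF wA] i _]; last first.
      by rewrite /F'; case: eqP => [->//|/eqP ij]; exact: wF.
    split => [i /= ij|]; last by have := wF j; rewrite /F' eqxx; apply; rewrite /= inE.
    by have := wF i; rewrite /F' (negbTE ij); apply; rewrite /= inE.
  have -> : \bigcap_(i in [set i | i \in [set~ j]%SET]) X i @^-1` F' i =
      \bigcap_(i in [set i | i != j]) X i @^-1` F i.
    apply: eq_bigcap => [|i /=]; first by split => i /=; rewrite !inE.
    by rewrite !inE /F' => /negbTE ->.
  move=> -> ->; rewrite (bigD1 j) ?inE//= {1}/F' eqxx; congr (_ * _)%E.
  by apply: eq_bigl => i; rewrite !inE.
have cover : \bigcup_(k : nat) (setT : set T) = setT.
  by apply/seteqP; split => // w _; exists 0%N.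
have fin k : (mrestr P mXA ((fun=> setT) (k : nat)) < +oo)%E.
  by rewrite /mrestr setTI ltey_eq fin_num_measure.
have E : mrestr P mXA (Y @^-1` B) = m2 (Y @^-1` B).
  exact: g_sigma_algebra_measure_unique G Gm (fun=> setT) (fun=> GT) cover _ _ GI
    eqG fin _ mY.
by move: E; rewrite /mrestr /m2 /mscale/= fineK ?fin_num_measure// setIC.
Qed.

(** The two measures on the plane agree on rectangles. *)
Lemma independent_joint_law (X Y : {RV P >-> R}) :
  (forall A B, measurable A -> measurable B ->
    P (X @^-1` A `&` Y @^-1` B) = P (X @^-1` A) * P (Y @^-1` B))%E ->
  forall S : set (R * R), measurable S ->
  (distribution P X \x distribution P Y)%E S = P [set w | S (X w, Y w)].
Proof.
move=> indXY S mS.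
have mXY : measurable_fun setT (fun w => (X w, Y w)).
  by apply: measurable_fun_pair; exact: measurable_funPT.
pose m' := pushforward P (fun w => (X w, Y w)).
exact: (@product_measure_unique _ _ _ _ _ _ _ m').
Qed.

End independence.

Lemma lebesgue_measureZ (R : realType) (y : R) (A : set (measurableTypeR R)) :
  0 < y -> measurable A ->
  lebesgue_measure ((fun x => y * x) @^-1` A) = ((y^-1)%:E * lebesgue_measure A)%E.
Proof.
move=> y0 mA.
have mM : measurable_fun setT ((fun x => y * x) : measurableTypeR R -> measurableTypeR R).
  exact: mulrl_measurable.
have nny : 0 <= y by exact: ltW.
pose m := mscale (NngNum nny) (pushforward lebesgue_measure
  ((fun x => y * x) : measurableTypeR R -> measurableTypeR R)).
suff -> : lebesgue_measure A = m mM A.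
  by rewrite /m /mscale/= muleA -EFinM mulVf ?gt_eqF// mul1e.
apply: lebesgue_measure_unique => // _ [[a b]] _ <-.
change (lebesgue_measure (`]a, b] : set R) =
  y%:E * lebesgue_measure ((fun x => (y * x)%R) @^-1` `]a, b]))%E.
have -> : (fun x => y * x) @^-1` `]a, b] = (`]a / y, b / y]%classic : set R).
  apply/seteqP; split => x /=; rewrite !in_itv/= ltr_pdivrMr// ler_pdivlMr//;
    by rewrite ![x * y]mulrC.
rewrite !lebesgue_measure_itv/= !lte_fin ltr_pM2r ?invr_gt0//.
case: ifPn => _; last by rewrite mule0.
by rewrite -!EFinB -EFinM -mulrBl mulrC divfK ?gt_eqF.
Qed.

Section product_lower_bound.
Context d (T : measurableType d) (R : realType) (P : probability T R).
Notation mu := (@lebesgue_measure R).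

(** Conditionally on [Y = y] with [y] in [[y0, y1]], the product falls in [A] when [X]
    falls in [A] scaled by [1 / y], a set on which [f >= m] and of measure
    [mu A / y >= mu A / y1]. *)
Lemma independent_product_law_ge (X Y : {RV P >-> R}) (f : R -> R) (m y0 y1 : R)
    (A : set R) :
  (forall A B, measurable A -> measurable B ->
    P (Y @^-1` A `&` X @^-1` B) = P (Y @^-1` A) * P (X @^-1` B))%E ->
  has_density P X f -> measurable A -> 0 <= m -> 0 < y0 ->
  (forall x y, y0 <= y <= y1 -> A (y * x) -> m <= f x) ->
  ((m / y1)%:E * mu A * P (Y @^-1` `[y0, y1]) <= P [set w | A (Y w * X w)%R])%E.
Proof.
move=> indYX [mf f0 denf] mA m0 y00 mf_le.
pose S : set (R * R) := (fun p => p.1 * p.2) @^-1` A.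
have mS : measurable S.
  rewrite -[S]setTI; apply: (_ : measurable_fun setT (fun p : R * R => p.1 * p.2)) => //.
  exact: measurable_funM.
rewrite -[leRHS](independent_joint_law indYX mS).
have [y01|y10] := leP y0 y1; last first.
  rewrite set_itv_ge; last by rewrite bnd_simp -ltNge.
  by rewrite preimage_set0 measure0 mule0 measure_ge0.
have y1gt0 : 0 < y1 by exact: lt_le_trans y01.
have K0 : (0 <= (m / y1)%:E * mu A)%E.
  by rewrite mule_ge0 ?lee_fin ?divr_ge0// ltW.
rewrite /product_measure1.
apply: (@le_trans _ _ (\int[distribution P Y]_(y in `[y0, y1]) ((m / y1)%:E * mu A))%E).
  by rewrite integral_cst.
apply: (@le_trans _ _ (\int[distribution P Y]_(y in `[y0, y1])
    (distribution P X \o xsection S) y)%E); last first.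
  apply: ge0_subset_integral => //.
  exact: measurable_fun_xsection.
apply: ge0_le_integral => //.
  by apply: measurable_funTS; exact: measurable_fun_xsection.
move=> y; rewrite /= in_itv/= => yy.
have ygt0 : 0 < y by case/andP: yy => + _; exact: lt_le_trans.
have -> : xsection S y = (fun x => y * x) @^-1` A.
  by apply/seteqP; split => x; rewrite /xsection /= ?inE.
have mB : measurable ((fun x => y * x) @^-1` A).
  rewrite -[X in measurable X]setTI.
  by apply: (mulrl_measurable y) => //; exact: measurableT.
rewrite denf//.
apply: (@le_trans _ _ (\int[mu]_(x in (fun x => (y * x)%R) @^-1` A) (m%:E))%E); last first.
  apply: ge0_le_integral => //.
  - by apply/measurable_EFinP/measurable_funTS.
  - by move=> x Ax; rewrite lee_fin; exact: mf_le yy Ax.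
rewrite integral_cst// [X in (_ <= _ * X)%E](lebesgue_measureZ ygt0 mA) muleA -EFinM.
rewrite lee_wpmul2r//.
by rewrite lee_fin ler_wpM2l// lef_pV2 ?posrE//; case/andP: yy.
Qed.

End product_lower_bound.

(** * Lower bounds for one factor *)

(** The hazard bound [A / s] times the tail bound at [s]. *)
Definition hazard_floor (R : realType) (A B alpha beta gamma s : R) : R :=
  A / s * (B * s `^ gamma * expR (- (alpha * s `^ beta))).

Section one_factor.
Context d (T : measurableType d) (R : realType) (P : probability T R).
Context (X : {RV P >-> R}) (f : R -> R) (x0 A B alpha beta gamma : R).
Hypotheses (denf : has_density P X f) (symf : forall x, f (- x) = f x).
Hypotheses (x01 : 1 <= x0) (A0 : 0 < A) (B0 : 0 < B).
Hypothesis hazard : forall x, x0 <= x -> f x / tail P X x >= A / x.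
Hypothesis tailP : forall x, x0 <= x ->
  tail P X x >= B * x `^ gamma * expR (- (alpha * x `^ beta)).
Notation floor := (hazard_floor A B alpha beta gamma).

Lemma tail_antitone x y : x <= y -> tail P X y <= tail P X x.
Proof.
move=> xy; rewrite /tail lerB// fine_le ?fin_num_measure//.
exact: cdf_nondecreasing.
Qed.

Lemma hazard_floor_gt0 s : 0 < s -> 0 < floor s.
Proof. by move=> s0; rewrite /hazard_floor !mulr_gt0 ?invr_gt0 ?powR_gt0 ?expR_gt0. Qed.

(** The hazard bound at [|x|] is at least [A / s], and the tail at [|x|] is at least
    the tail at [s]. *)
Lemma density_ge_hazard_floor s x : x0 <= `|x| -> `|x| <= s -> floor s <= f x.
Proof.
move=> xl xs.
have -> : f x = f `|x| by case: (ger0P x) => // _; rewrite symf.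
move: `|x| xl xs => {}x xl xs.
have xgt0 : 0 < x by rewrite (lt_le_trans _ xl)// (lt_le_trans _ x01).
have sgt0 : 0 < s by exact: lt_le_trans xs.
have x0s : x0 <= s by exact: le_trans xs.
have tail_gt0 y : x0 <= y -> 0 < tail P X y.
  move=> x0y; have y0 : 0 < y by rewrite (lt_le_trans _ x0y)// (lt_le_trans _ x01).
  by apply: lt_le_trans (tailP x0y); rewrite !mulr_gt0 ?powR_gt0 ?expR_gt0.
have := hazard xl; rewrite ler_pdivlMr ?tail_gt0// => /(le_trans _); apply.
rewrite /hazard_floor; apply: ler_pM.
- by rewrite divr_ge0// ltW.
- by rewrite !mulr_ge0 ?powR_ge0 ?expR_ge0// ltW.
- by rewrite ler_pM2l// lef_pV2.
- by apply: le_trans (tailP x0s) _; exact: tail_antitone.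
Qed.

(** The interval has length [t >= 1]. *)
Lemma probability_dyadic_ge t : x0 <= t ->
  ((floor (2 * t)%R)%:E <= P (X @^-1` `[t, (2 * t)%R]))%E.
Proof.
move=> x0t; have t1 : 1 <= t by exact: le_trans x0t.
have t0 : 0 < t by exact: lt_le_trans t1.
have [mf f0 E] := denf.
rewrite [leRHS](E `[t, 2 * t]%classic)//.
have F0 : 0 < floor (2 * t) by rewrite hazard_floor_gt0// mulr_gt0.
apply: (@le_trans _ _ (\int[lebesgue_measure]_(x in `[t, (2 * t)%R]) (floor (2 * t)%R)%:E)%E).
  rewrite integral_cst//= lebesgue_measure_itv/= lte_fin ltr_pMl// ltr1n.
  rewrite -EFinB -EFinM lee_fin ler_peMr//; first exact: ltW.
  by rewrite mulr_natl mulr2n addrK.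
apply: ge0_le_integral => //.
- by move=> x _; rewrite lee_fin ltW.
- exact/measurable_EFinP/measurable_funTS.
- move=> x; rewrite /= in_itv/= => /andP[tx x2t]; rewrite lee_fin.
  have x00 : 0 <= x by rewrite (le_trans (ltW t0)).
  by apply: density_ge_hazard_floor; rewrite ger0_norm// (le_trans x0t).
Qed.

End one_factor.

(** * Functions decaying more slowly than a stretched exponential *)

Section subexponential.
Context (R : realType) (eta : R) (eta0 : 0 < eta).
Implicit Types (g h : R -> R).

(** All the factors of the lower bound for the law of the product have this property;
    having it for every [e > 0] makes it stable under products. *)
Definition subexponential g : Prop :=
  forall e, 0 < e -> \forall X \near +oo, expR (- (e * X `^ eta)) <= g X.

Lemma near_powR_ge (r M : R) : 0 < r -> \forall X \near +oo, M <= X `^ r.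
Proof.
move=> r0; near=> X.
have X0 : 0 <= X by near: X; exact: nbhs_pinfty_ge.
have MX : `|M| `^ r^-1 <= X by near: X; apply: nbhs_pinfty_ge; rewrite num_real.
rewrite (le_trans (ler_norm M))// -[leLHS]powRr1// -(@mulVf _ r) ?gt_eqF// powRrM.
by apply: ge0_ler_powR; rewrite ?nnegrE ?powR_ge0// ltW.
Unshelve. all: by end_near. Qed.

Lemma subexponential_le g h : subexponential g ->
  (\forall X \near +oo, g X <= h X) -> subexponential h.
Proof.
move=> sg gh e e0; near=> X; apply: (@le_trans _ _ (g X)); near: X => //.
exact: sg.
Unshelve. all: by end_near. Qed.

Lemma subexponential_cst C : 0 < C -> subexponential (cst C).
Proof.
move=> C0 e e0; near=> X.
rewrite -[leRHS](lnK C0) ler_expR lerNl mulrC -ler_pdivrMr//.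
by near: X; exact: near_powR_ge.
Unshelve. all: by end_near. Qed.

Lemma subexponential_powR (p : R) : subexponential (fun X => X `^ p).
Proof.
move=> e e0; have [C C0 HC] := powR_expR_bounded (1 - p) e0 eta0.
near=> X.
have X1 : 1 <= X by near: X; exact: nbhs_pinfty_ge.
have CX : C <= X by near: X; apply: nbhs_pinfty_ge; rewrite num_real.
have X0 : 0 < X by exact: lt_le_trans X1.
have := le_trans (HC _ X1) CX.
rewrite powRB ?(gt_eqF X0) ?implybT// powRr1 ?(ltW X0)// -mulrA ger_pMr//.
by rewrite mulrC ler_pdivrMr ?powR_gt0// mul1r.
Unshelve. all: by end_near. Qed.

Lemma subexponential_expR (K rho : R) : rho < eta ->
  subexponential (fun X => expR (- (K * X `^ rho))).
Proof.
move=> re e e0; near=> X.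
have X0 : 0 < X by near: X; exact: nbhs_pinfty_gt.
rewrite ler_expR lerN2 -[in leRHS](subrK rho eta).
rewrite powRD ?(gt_eqF X0) ?implybT// mulrA ler_wpM2r ?powR_ge0//.
rewrite mulrC -ler_pdivrMr//.
by near: X; apply: near_powR_ge; rewrite subr_gt0.
Unshelve. all: by end_near. Qed.

Lemma subexponentialM g h : subexponential g -> subexponential h ->
  subexponential (fun X => g X * h X).
Proof.
move=> sg sh e e0; have e20 : 0 < e / 2 by rewrite divr_gt0.
near=> X.
rewrite {1}(splitr e) mulrDl opprD expRD.
apply: ler_pM; rewrite ?expR_ge0//; near: X; [exact: sg|exact: sh].
Unshelve. all: by end_near. Qed.

Lemma subexponential_prod (I : Type) (s : seq I) (Q : pred I) (g : I -> R -> R) :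
  (forall i, Q i -> subexponential (g i)) ->
  subexponential (fun X => \prod_(i <- s | Q i) g i X).
Proof.
move=> sg; elim: s => [|i s IH].
  rewrite (_ : (fun _ => _) = cst 1); last by apply/funext => X; rewrite big_nil.
  exact: subexponential_cst.
rewrite (_ : (fun _ => _) = if Q i then (fun X => g i X * \prod_(k <- s | Q k) g k X)
  else (fun X => \prod_(k <- s | Q k) g k X)); last first.
  by apply/funext => X; rewrite big_cons; case: ifP.
case: ifPn => // Qi.
by apply: subexponentialM => //; exact: sg.
Qed.

(** At [s = 2 * X ^ w] the exponential factor is [exp (- K * X ^ (w * be))]. *)
Lemma subexponential_hazard_floor (A B al be ga w : R) : 0 < A -> 0 < B ->
  w * be < eta ->
  subexponential (fun X => hazard_floor A B al be ga (2 * X `^ w)).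
Proof.
move=> A0 B0 wbe.
have s1 : subexponential (fun X => A * (2^-1 * X `^ (- w))).
  apply: subexponentialM; first exact: subexponential_cst.
  apply: subexponentialM; last exact: subexponential_powR.
  by apply: subexponential_cst; rewrite invr_gt0.
have s2 : subexponential (fun X => B * (2 `^ ga * X `^ (w * ga))).
  apply: subexponentialM; first exact: subexponential_cst.
  apply: subexponentialM; last exact: subexponential_powR.
  by apply: subexponential_cst; rewrite powR_gt0.
have s3 := @subexponential_expR (al * 2 `^ be) _ wbe.
apply: subexponential_le (subexponentialM s1 (subexponentialM s2 s3)) _.
near=> X; have X0 : 0 < X by near: X; exact: nbhs_pinfty_gt.
rewrite /hazard_floor !powRM ?powR_ge0// -!powRrM powRN invfM.
by rewrite !mulrA.
Unshelve. all: by end_near. Qed.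

End subexponential.

(** * Lower bound for the law of the product *)

Section product_lower_bound_factors.
Context d (T : measurableType d) (R : realType) (P : probability T R).
Context (I : finType) (X : I -> {RV P >-> R}) (f : I -> R -> R) (j : I).
Context (x0 : R) (A B alpha beta gamma : I -> R).
Hypothesis indep : mutually_independent P X.
Hypotheses (dens : forall i, has_density P (X i) (f i))
           (symf : forall i x, f i (- x) = f i x) (x01 : 1 <= x0)
           (A0 : forall i, 0 < A i) (B0 : forall i, 0 < B i)
           (beta0 : forall i, 0 < beta i).
Hypothesis hazard : forall i x, x0 <= x -> f i x / tail P (X i) x >= A i / x.
Hypothesis tailP : forall i x, x0 <= x ->
  tail P (X i) x >= B i * x `^ gamma i * expR (- (alpha i * x `^ beta i)).

Let rho : R := (\sum_i (beta i)^-1)^-1.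
Let w i : R := rho / beta i.
Let floor i (Z : R) := hazard_floor (A i) (B i) (alpha i) (beta i) (gamma i) (2 * Z `^ w i).

Let sumV_gt0 : 0 < \sum_i (beta i)^-1.
Proof.
rewrite (bigD1 j)//= ltr_wpDr ?invr_gt0//.
by apply: sumr_ge0 => i _; rewrite invr_ge0 ltW.
Qed.

Let sum_w : \sum_i w i = 1.
Proof. by rewrite /w -mulr_sumr mulVf// gt_eqF. Qed.

Let rho0 : 0 < rho. Proof. by rewrite invr_gt0. Qed.

Let w0 i : 0 < w i. Proof. by rewrite divr_gt0. Qed.

(** The product of the other factors lies in this interval as soon as each factor [i]
    lies in [[Z ^ w i, 2 * Z ^ w i]]; these events are independent. *)
Lemma probability_others_product_ge Z : 0 < Z -> (forall i, x0 <= Z `^ w i) ->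
  ((\prod_(i | i != j) floor i Z)%:E <=
    P (others_product X j @^-1`
      `[(\prod_(i | i != j) Z `^ w i)%R, (\prod_(i | i != j) (2 * Z `^ w i))%R]))%E.
Proof.
move=> Z0 x0Z.
pose F i : set R := `[Z `^ w i, 2 * Z `^ w i]%classic.
have t0 i : 0 <= Z `^ w i by exact: powR_ge0.
have := indep [set~ j]%SET (fun i => measurable_itv _ : measurable (F i)).
set E := \bigcap_(i in _) _ => EP.
apply: (@le_trans _ _ (P E)).
  rewrite EP -prodEFin [leRHS](eq_bigl (fun i => i != j)); last by move=> i; rewrite !inE.
  set p := (\prod_(i | i != j) P _)%E.
  have [] : (0 <= (\prod_(i | i != j) (floor i Z)%:E) /\
    (\prod_(i | i != j) (floor i Z)%:E) <= p)%E.
    rewrite /p; elim/big_rec2 : _ => [|i p1 p2 ij [p20 p21]]; first by rewrite lee01.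
    have fl0 : (0 <= (floor i Z)%:E)%E.
      by rewrite lee_fin ltW// hazard_floor_gt0// mulr_gt0// powR_gt0.
    split; first exact: mule_ge0.
    apply: lee_pmul => //.
    exact: (probability_dyadic_ge (dens i) (symf i) x01 (A0 i) (B0 i) (hazard i)
      (tailP i) (x0Z i)).
  by [].
apply: le_measure; rewrite ?inE.
- apply: fin_bigcap_measurable => [|i _]; first exact: finite_finset.
  by rewrite -[X in measurable X]setTI; apply: measurable_funPT => //; exact: measurable_itv.
- by rewrite -[X in measurable X]setTI; apply: measurable_funPT => //; exact: measurable_itv.
- move=> t tE; rewrite /= in_itv/=.
  have tF i : i != j -> Z `^ w i <= X i t <= 2 * Z `^ w i.
    by move=> ij; have := tE i; rewrite /= !inE ij /F/= in_itv/=; apply.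
  rewrite /others_product; apply/andP; split; apply: ler_prod => i ij.
    by rewrite t0; case/andP: (tF i ij).
  by case/andP: (tF i ij) => a b; rewrite b (le_trans (t0 i) a).
Qed.

(** When the product of the others lies in [[y0, y1]] and [Z <= |y * x| <= 2 * Z], the
    factor [j] satisfies [Z ^ w j / 2 ^ #|I| <= |x| <= 2 * Z ^ w j], because
    [y0 * Z ^ w j = Z]; its density is then at least [floor j Z]. *)
Lemma product_law_ge_subexponential (eta e : R) : rho < eta -> 0 < e ->
  \forall Z \near +oo, forall S : set R, measurable S ->
    S `<=` [set z | Z <= `|z| <= 2 * Z] ->
  ((expR (- (e * Z `^ eta)))%:E * lebesgue_measure S <=
    P [set t | S (\prod_i X i t)%R])%E.
Proof.
move=> rho_eta e0.
have eta0 : 0 < eta by exact: lt_trans rho_eta.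
pose g Z := floor j Z * \prod_(i | i != j) (floor i Z * (2^-1 * Z `^ (- w i))).
have floor_sub i : subexponential eta (floor i).
  apply: (subexponential_hazard_floor eta0) => //.
  by rewrite /w divfK// gt_eqF.
have g_sub : subexponential eta g.
  apply: subexponentialM => //; apply: (subexponential_prod eta0) => i _.
  apply: subexponentialM => //; apply: subexponentialM; last exact: (subexponential_powR eta0).
  by apply: (subexponential_cst eta0); rewrite invr_gt0.
have large : \forall Z \near +oo, forall i, 2 ^+ #|I| * x0 <= Z `^ w i.
  by apply: filter_forall => i; exact: near_powR_ge (w0 i).
near=> Z => S mS SZ.
have Z0 : 0 < Z by near: Z; exact: nbhs_pinfty_gt.
have ZI i : 2 ^+ #|I| * x0 <= Z `^ w i.
  by move: i; near: Z; exact: large.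
have gZ : expR (- (e * Z `^ eta)) <= g Z by near: Z; exact: g_sub.
have two1 : 1 <= 2 ^+ #|I| :> R by rewrite exprn_ege1// ler1n.
have x00 : 0 < x0 by exact: lt_le_trans x01.
have x0Z i : x0 <= Z `^ w i by apply: le_trans (ZI i); rewrite ler_peMl// ltW.
pose y0 := \prod_(i | i != j) Z `^ w i.
pose y1 := \prod_(i | i != j) (2 * Z `^ w i).
have t0 i : 0 < Z `^ w i by exact: powR_gt0.
have y00 : 0 < y0 by apply: prodr_gt0.
have y10 : 0 < y1 by apply: prodr_gt0 => i _; rewrite mulr_gt0.
have y0Z : y0 * Z `^ w j = Z.
  rewrite /y0 -powR_sum// -powRD ?(gt_eqF Z0) ?implybT//.
  by have := sum_w; rewrite (bigD1 j)//= addrC => ->; rewrite powRr1// ltW.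
have y1y0 : y1 <= 2 ^+ #|I| * y0.
  rewrite /y1 big_split/= ler_wpM2r ?(ltW y00)// prodr_const.
  by rewrite ler_weXn2l ?ler1n// max_card.
have floor0 i : 0 < floor i Z by rewrite hazard_floor_gt0// mulr_gt0.
have mf_le x y : y0 <= y <= y1 -> S (y * x) -> floor j Z <= f j x.
  move=> /andP[y0y yy1] /SZ/= /andP[].
  have y_gt0 : 0 < y by exact: lt_le_trans y0y.
  rewrite normrM (gtr0_norm y_gt0) => Zx xZ.
  apply: (density_ge_hazard_floor (symf j) x01 (A0 j) (B0 j) (hazard j) (tailP j)).
    rewrite -(ler_pM2l y10).
    apply: le_trans (ler_wpM2r (ltW x00) y1y0) _.
    rewrite mulrAC.
    apply: le_trans (ler_wpM2r (ltW y00) (ZI j)) _.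
    by rewrite mulrC y0Z (le_trans Zx)// ler_wpM2r.
  rewrite -(ler_pM2l y00) mulrCA y0Z.
  by apply: le_trans xZ; rewrite ler_wpM2r.
have indYX (E F : set R) : measurable E -> measurable F ->
  (P (others_product X j @^-1` E `&` X j @^-1` F) =
   P (others_product X j @^-1` E) * P (X j @^-1` F))%E.
  move=> mE mF; rewrite setIC muleC.
  exact: mutually_independent_prod_others.
have := independent_product_law_ge indYX (dens j) mS (ltW (floor0 j)) y00 mf_le.
have -> : [set t | S (others_product X j t * X j t)] = [set t | S (\prod_i X i t)].
  by apply/seteqP; split => t /=; rewrite (bigD1 j)//= mulrC.
apply: le_trans.
have gE : g Z = floor j Z / y1 * \prod_(i | i != j) floor i Z.
  rewrite /g big_split/= mulrCA [RHS]mulrC; congr (_ * (_ * _)).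
  rewrite /y1 -prodfV; apply: eq_bigr => i _.
  by rewrite invfM powRN.
apply: (@le_trans _ _ ((g Z)%:E * lebesgue_measure S)%E).
  by rewrite lee_wpmul2r// lee_fin.
rewrite gE EFinM muleAC lee_wpmul2l//.
  by rewrite mule_ge0// lee_fin divr_ge0// ltW.
exact: probability_others_product_ge.
Unshelve. all: by end_near. Qed.

End product_lower_bound_factors.

(** * Perturbing a probability by a signed density *)

Section density_measure.
Context d (T : measurableType d) (R : realType).
Context (mu : {sigma_finite_measure set T -> \bar R}) (g : T -> R).

(** The hypotheses on [g] are arguments so that the structure of finite measure is
    found by unification. *)
Definition density_measure (g0 : forall x, 0 <= g x)
    (intg : mu.-integrable setT (EFin \o g)) (A : set T) : \bar R :=
  (\int[mu]_(x in A) (g x)%:E)%E.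

Context (g0 : forall x, 0 <= g x) (intg : mu.-integrable setT (EFin \o g)).
Notation nu := (density_measure g0 intg).

Let nu0 : nu set0 = 0%E. Proof. by rewrite /density_measure integral_set0. Qed.

Let nu_ge0 A : (0 <= nu A)%E.
Proof. by apply: integral_ge0 => x _; rewrite lee_fin. Qed.

Let nu_sigma_additive : semi_sigma_additive nu.
Proof.
apply: semi_sigma_additive_nng_induced; first exact: measurable_int intg.
by move=> x; rewrite lee_fin.
Qed.

HB.instance Definition _ := isMeasure.Build _ _ _ nu nu0 nu_ge0 nu_sigma_additive.

Let nu_fin : fin_num_fun nu.
Proof. by move=> A mA; apply: integrable_fin_num => //; exact: integrableS intg. Qed.

HB.instance Definition _ := Measure_isFinite.Build _ _ _ nu nu_fin.

Let numu : nu `<< mu.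
Proof.
apply/null_content_dominatesP => A mA muA0.
by apply: null_set_integral => //; exact: measurable_funTS (measurable_int mu intg).
Qed.

(** The Radon-Nikodym derivative of this measure is almost everywhere [g]. *)
Lemma ge0_integral_density_measure (f : T -> \bar R) :
  (forall x, 0 <= f x)%E -> measurable_fun setT f ->
  (\int[nu]_x f x = \int[mu]_x (f x * (g x)%:E))%E.
Proof.
move=> f0 mf; rewrite -(Radon_Nikodym_SigmaFinite.change_of_variables numu)//.
have intRN := Radon_Nikodym_SigmaFinite.f_integrable numu.
apply: ae_eq_integral => //.
- by apply: emeasurable_funM => //; exact: measurable_int intRN.
- by apply: emeasurable_funM => //; exact: measurable_int intg.
apply: ae_eqe_mul2l; apply: integral_ae_eq => //.
  by apply: measurable_int intg.
by move=> A _ mA; rewrite -Radon_Nikodym_SigmaFinite.f_integral.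
Qed.

Lemma integrable_density_measure (f : T -> \bar R) : measurable_fun setT f ->
  mu.-integrable setT (fun x => f x * (g x)%:E)%E -> nu.-integrable setT f.
Proof.
move=> mf /integrableP[_ fg]; apply/integrableP; split => //.
rewrite ge0_integral_density_measure//; last exact: measurableT_comp.
apply: le_lt_trans fg; rewrite le_eqVlt; apply/orP; left; apply/eqP.
by apply: eq_integral => x _; rewrite abseM [X in (_ = _ * X)%E]gee0_abs// lee_fin.
Qed.

Lemma integral_density_measure (f : T -> \bar R) : measurable_fun setT f ->
  mu.-integrable setT (fun x => f x * (g x)%:E)%E ->
  (\int[nu]_x f x = \int[mu]_x (f x * (g x)%:E))%E.
Proof.
move=> mf intfg; have intf := integrable_density_measure mf intfg.
rewrite -(Radon_Nikodym_change_of_variables numu _ intf)//.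
have intRN : mu.-integrable setT (Radon_Nikodym (charge_of_finite_measure nu) mu).
  exact: Radon_Nikodym_integrable.
apply: ae_eq_integral => //.
- by apply: emeasurable_funM => //; exact: measurable_int intRN.
- exact: measurable_int intfg.
apply: ae_eqe_mul2l; apply: integral_ae_eq => //.
  by apply: measurable_int intg.
by move=> A _ mA; rewrite -Radon_Nikodym_integral.
Qed.

End density_measure.

Section perturbed_probability.
Context d (T : measurableType d) (R : realType).
Context (mu : {sigma_finite_measure set T -> \bar R}) (nu : probability T R).
Context (psi : T -> R).

(** The conditions on [psi] are arguments so that the structure of probability is
    found by unification.  The restriction sends non-measurable sets to 0, since a
    measure is nonnegative on all sets. *)
Definition perturbed_probability (intpsi : mu.-integrable setT (EFin \o psi))
    (pos : forall A, measurable A -> (0 <= nu A + \int[mu]_(x in A) (psi x)%:E)%E)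
    (int0 : (\int[mu]_x (psi x)%:E = 0)%E) : set T -> \bar R :=
  crestr0 (cadd (charge_of_finite_measure nu) (induced_charge intpsi)) measurableT.

Context (intpsi : mu.-integrable setT (EFin \o psi))
  (pos : forall A, measurable A -> (0 <= nu A + \int[mu]_(x in A) (psi x)%:E)%E)
  (int0 : (\int[mu]_x (psi x)%:E = 0)%E).
Notation Q := (perturbed_probability intpsi pos int0).

Lemma perturbed_probabilityE A : measurable A ->
  Q A = (nu A + \int[mu]_(x in A) (psi x)%:E)%E.
Proof. by move=> mA; rewrite /perturbed_probability /crestr0 mem_set// /crestr setIT. Qed.

Let Q0 : Q set0 = 0%E. Proof. exact: charge0. Qed.

Let Q_ge0 A : (0 <= Q A)%E.
Proof.
have [mA|nmA] := pselect (measurable A); first by rewrite perturbed_probabilityE// pos.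
by rewrite /perturbed_probability /crestr0 memNset.
Qed.

Let Q_sigma_additive : semi_sigma_additive Q.
Proof. exact: charge_semi_sigma_additive. Qed.

HB.instance Definition _ := isMeasure.Build _ _ _ Q Q0 Q_ge0 Q_sigma_additive.

Let Q_setT : Q setT = 1%E.
Proof. by rewrite perturbed_probabilityE// probability_setT [X in (_ + X)%E]int0 adde0. Qed.

HB.instance Definition _ := Measure_isProbability.Build _ _ _ Q Q_setT.

(** Adding to [Q] the measure of density the negative part of [psi], and to [nu] the
    one of density the positive part, gives the same positive measure; the integrals
    of [p] against the two densities agree by hypothesis. *)
Lemma integral_perturbed_probability (p : T -> R) : measurable_fun setT p ->
  nu.-integrable setT (EFin \o p) ->
  mu.-integrable setT (fun x => (p x * psi x)%:E) ->
  (\int[mu]_x (p x * psi x)%:E = 0)%E ->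
  Q.-integrable setT (EFin \o p) /\ (\int[Q]_x (p x)%:E = \int[nu]_x (p x)%:E)%E.
Proof.
move=> mp nup mup I0.
have psip0 x : 0 <= (psi^\+)%R x by exact: funrpos_ge0.
have psin0 x : 0 <= (psi^\-)%R x by exact: funrneg_ge0.
have ip : mu.-integrable setT (EFin \o (psi^\+)%R) by exact: integrable_funrpos.
have iN : mu.-integrable setT (EFin \o (psi^\-)%R) by exact: integrable_funrneg.
have psiE x : psi x = (psi^\+)%R x - (psi^\-)%R x.
  by rewrite -[in LHS](funrposBneg psi).
pose mp' := density_measure psip0 ip.
pose mn' := density_measure psin0 iN.
have E A : measurable A -> measure_add Q mn' A = measure_add nu mp' A.
  move=> mA; rewrite !measure_addE.
  change (Q A + mn' A = nu A + mp' A)%E.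
  rewrite perturbed_probabilityE// -addeA; congr (_ + _)%E.
  rewrite /mn' /mp' /density_measure -integralD//; last 2 first.
  - exact: integrableS intpsi.
  - by apply: (integrableS _ _ _ iN).
  by apply: eq_integral => x _; rewrite -EFinD psiE subrK.
have mEp : measurable_fun setT (EFin \o p) by exact/measurable_EFinP.
have mupp : mu.-integrable setT (fun x => (EFin \o p) x * ((psi^\+)%R x)%:E)%E.
  apply: le_integrable mup => //.
    by apply: emeasurable_funM => //; exact: measurable_int ip.
  move=> x _; rewrite lee_fin !normrM ler_wpM2l//.
  have /= <- := congr1 (@^~ x) (funrposDneg psi).
  by rewrite ger0_norm// lerDl.
have mupn : mu.-integrable setT (fun x => (EFin \o p) x * ((psi^\-)%R x)%:E)%E.
  apply: le_integrable mup => //.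
    by apply: emeasurable_funM => //; exact: measurable_int iN.
  move=> x _; rewrite lee_fin !normrM ler_wpM2l//.
  have /= <- := congr1 (@^~ x) (funrposDneg psi).
  by rewrite ger0_norm// lerDr.
have ipp : mp'.-integrable setT (EFin \o p) by exact: integrable_density_measure.
have ipn : mn'.-integrable setT (EFin \o p) by exact: integrable_density_measure.
have absE : (\int[Q]_x `|(EFin \o p) x| + \int[mn']_x `|(EFin \o p) x| =
             \int[nu]_x `|(EFin \o p) x| + \int[mp']_x `|(EFin \o p) x|)%E.
  have mabs : measurable_fun setT (fun x => `|(EFin \o p) x|%E) by exact: measurableT_comp.
  rewrite -!ge0_integral_measure_add//.
  by apply: eq_measure_integral => A mA _; exact: E.
have iQ : Q.-integrable setT (EFin \o p).
  apply/integrableP; split => //.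
  apply: (@le_lt_trans _ _ (\int[Q]_x `|(EFin \o p) x| + \int[mn']_x `|(EFin \o p) x|)%E).
    by rewrite leeDl// integral_ge0.
  rewrite absE lte_add_pinfty//.
  - by case/integrableP: nup.
  - by case/integrableP: ipp.
split => //.
have sumE : (\int[Q]_x (p x)%:E + \int[mn']_x (p x)%:E =
             \int[nu]_x (p x)%:E + \int[mp']_x (p x)%:E)%E.
  rewrite -!integral_measure_add//.
  by apply: eq_measure_integral => A mA _; exact: E.
have fin : (\int[mn']_x (p x)%:E \is a fin_num)%E by exact: integrable_fin_num.
have pn : (\int[mp']_x (p x)%:E - \int[mn']_x (p x)%:E = 0)%E.
  rewrite (integral_density_measure psip0 ip mEp mupp).
  rewrite (integral_density_measure psin0 iN mEp mupn).
  rewrite -integralB// -[RHS]I0; apply: eq_integral => x _.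
  by rewrite /= -EFinB -mulrBr -psiE.
by rewrite -[LHS](addeK _ fin) sumE -addeA pn adde0.
Qed.

End perturbed_probability.

(** * Moment indeterminacy of the product *)

Lemma charge_ge0_of_cover d (T : measurableType d) (R : realType)
    (nu : {charge set T -> \bar R}) (S : nat -> set T) :
  (forall n, measurable (S n)) -> trivIset setT S -> \bigcup_n S n = setT ->
  (forall n A, measurable A -> A `<=` S n -> (0 <= nu A)%E) ->
  forall A, measurable A -> (0 <= nu A)%E.
Proof.
move=> mS tS covS nuS A mA.
have AE : A = \bigcup_n (A `&` S n) by rewrite -setI_bigcupr covS setIT.
have mAS n : measurable (A `&` S n) by exact: measurableI.
have tAS : trivIset setT (fun n => A `&` S n) by exact: trivIset_setIl.
have mU : measurable (\bigcup_n (A `&` S n)) by rewrite -AE.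
have := @charge_semi_sigma_additive _ _ _ nu (fun n => A `&` S n) mAS tAS mU.
rewrite -AE; apply: cvge_ge; apply: nearW => n.
by apply: sume_ge0 => i _; exact: nuS (mAS i) (@subIsetr _ _ _).
Qed.

Section finite_moments_product.
Context d (T : measurableType d) (R : realType) (P : probability T R).
Context (I : finType) (X : I -> {RV P >-> R}).

(** The product is at most a power of its largest factor, so its moments are bounded
    by those of the single factors. *)
Lemma ler_norm_prod_sum (x : I -> R) (k : nat) (j : I) :
  `|(\prod_i x i) ^+ k| <= \sum_i `|x i ^+ (#|I| * k)|.
Proof.
pose i0 := [arg max_(i > j) `|x i|]%O.
have x_le i : `|x i| <= `|x i0|.
  by rewrite /i0; case: arg_maxP => // i' _; apply.
apply: (@le_trans _ _ `|x i0 ^+ (#|I| * k)|); last first.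
  by rewrite [leRHS](bigD1 i0)//= lerDl sumr_ge0.
rewrite !normrX exprM lerXn2r ?nnegrE ?exprn_ge0//.
rewrite normr_prod -prodr_const.
by apply: ler_prod => i _; rewrite normr_ge0 x_le.
Qed.

Lemma finite_moments_product (j : I) : (forall i, finite_moments P (X i)) ->
  finite_moments P (product_RV P X).
Proof.
move=> mom k k0.
have I0 : (0 < #|I|)%N by apply/card_gt0P; exists j.
have int_sum : P.-integrable setT (fun w => \sum_i `|(X i w ^+ (#|I| * k))%:E|)%E.
  apply: (@integrable_sum _ _ _ _ _ _ _ (index_enum I) xpredT
    (fun i w => `|(X i w ^+ (#|I| * k))%:E|)%E) => // i _.
  by apply: integrable_abse; apply: mom; rewrite muln_gt0 I0.
apply: le_integrable int_sum => //.
  apply/measurable_EFinP; apply: measurable_funX; exact: measurable_funPT.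
move=> w _; rewrite /= sumEFin lee_fin.
apply: le_trans (ler_norm_prod_sum (fun i => X i w) k j) _.
exact: ler_norm.
Qed.

End finite_moments_product.

Section shells.
Context (R : realType).

Definition shell (n : nat) : set R := [set z | n%:R <= `|z| < n.+1%:R].

Lemma measurable_shell n : measurable (shell n).
Proof.
have -> : shell n = (fun z : R => `|z|) @^-1` `[n%:R, n.+1%:R[.
  by apply/seteqP; split => z /=; rewrite in_itv/=.
by rewrite -[X in measurable X]setTI; exact: normr_measurable.
Qed.

Lemma trivIset_shell : trivIset setT shell.
Proof.
apply/trivIsetP => m n _ _ mn; apply/seteqP; split => // z [mz nz].
by move: mn; rewrite -(truncn_def mz) -(truncn_def nz) eqxx.
Qed.

Lemma bigcup_shell : \bigcup_n shell n = setT.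
Proof.
apply/seteqP; split => // z _; exists (Num.truncn `|z|) => //=.
exact: truncn_itv.
Qed.

End shells.

(** By countable additivity it is enough to look inside one shell.  The perturbation
    vanishes on the shells below [N], and on the others it is dominated by [nu]. *)
Lemma odd_bump_perturbation_ge0 (R : realType) (lam : R) (N : nat)
    (nu : probability (measurableTypeR R) R) :
  (0 < N)%N -> 0 < lam -> lam < 2^-1 ->
  (forall (n : nat) (S : set R), (N <= n)%N -> measurable S -> S `<=` @shell R n ->
    ((expR (- (cos (pi * lam) * n%:R `^ (2 * lam))))%:E * lebesgue_measure S <= nu S)%E) ->
  forall A, measurable A ->
    (0 <= nu A + \int[lebesgue_measure]_(x in A) (odd_bump N%:R lam x)%:E)%E.
Proof.
move=> N0 lam0 lam12 nu_ge.
have N1 : 1 <= N%:R :> R by rewrite ler1n.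
have int1 : lebesgue_measure.-integrable setT (EFin \o odd_bump (R := R) N%:R lam).
  have := integrable_odd_bump N1 lam0 lam12 0.
  by apply: eq_integrable => // x _ /=; rewrite expr0 mul1r.
pose ch := cadd (charge_of_finite_measure nu) (induced_charge int1).
apply: (@charge_ge0_of_cover _ _ _ ch (@shell R) (@measurable_shell R)
  (@trivIset_shell R) (@bigcup_shell R)) => n A mA An.
change (0 <= nu A + \int[lebesgue_measure]_(x in A) (odd_bump N%:R lam x)%:E)%E.
have [nN|Nn] := ltnP n N.
  rewrite (_ : \int[_]_(x in A) _ = 0)%E ?adde0 ?measure_ge0//.
  apply: integral0_eq => x /An /andP[_ xn] /=.
  by rewrite odd_bump0// (lt_le_trans xn)// ler_nat.
have n1 : 1 <= n%:R :> R by rewrite ler1n (leq_trans N0).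
have intA : lebesgue_measure.-integrable A (EFin \o odd_bump (R := R) N%:R lam).
  by apply: (integrableS _ _ _ int1).
have fI := integrable_fin_num mA intA.
have absI : (`|\int[lebesgue_measure]_(x in A) (odd_bump N%:R lam x)%:E| <= nu A)%E.
  apply: le_trans (nu_ge n A Nn mA An).
  apply: le_trans (le_abse_integral _ mA (measurable_int _ intA)) _.
  rewrite -integral_cst//; apply: ge0_le_integral => //.
  - by apply: measurableT_comp => //; exact: measurable_int intA.
  - move=> x /An /andP[nx _]; rewrite /= lee_fin.
    by apply: odd_bump_bound.
have fnu : nu A \is a fin_num by exact: fin_num_measure.
move: absI; rewrite -(fineK fI) -(fineK fnu) -EFinD !lee_fin => absI.
by rewrite -lerBlDl sub0r; exact: lerNnormlW.
Qed.

Theorem theorem10 (R : realType) (d : measure_display) (T : measurableType d)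
    (P : probability T R) (n : nat) (hn : (2 <= n)%N)
    (xi : 'I_n -> {RV P >-> R})
    (hindep : mutually_independent P xi)
    (hmom : forall i, finite_moments P (xi i))
    (f : 'I_n -> R -> R)
    (hdens : forall i, has_density P (xi i) (f i))
    (hpos : forall i x, 0 < f i x)
    (hsym : forall i x, f i (- x) = f i x)
    (x0 : R) (hx0 : 1 <= x0)
    (hdecr : exists i, forall x y, x0 <= x -> x <= y -> f i y <= f i x)
    (A B alpha beta gamma : 'I_n -> R)
    (hA : forall i, 0 < A i) (hB : forall i, 0 < B i)
    (halpha : forall i, 0 < alpha i) (hbeta : forall i, 0 < beta i)
    (hhazard : forall i x, x0 <= x -> f i x / tail P (xi i) x >= A i / x)
    (htail : forall i x, x0 <= x ->
      tail P (xi i) x >=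
        B i * x `^ gamma i * expR (- (alpha i * x `^ beta i)))
    (hsum : \sum_(i < n) (beta i)^-1 > 1) :
  M_indet P (product_RV P xi).
Proof.
have j : 'I_n by exact: Ordinal hn.
have hmomZ : finite_moments P (product_RV P xi) by exact: finite_moments_product j hmom.
split => // -[_ uniq].
set rho := (\sum_(i < n) (beta i)^-1)^-1.
have rho0 : 0 < rho by rewrite invr_gt0 (lt_trans ltr01).
have rho1 : rho < 1 by rewrite invf_lt1// (lt_trans ltr01).
(* 2 * lam is the midpoint of rho and 1 *)
pose lam := (rho + 1) / 4.
have lam0 : 0 < lam by rewrite divr_gt0// addr_gt0.
have lam12 : lam < 2^-1 by rewrite /lam; lra.
have rholam : rho < 2 * lam by rewrite /lam; lra.
have a0 : 0 < cos (pi * lam) by exact: cos_pilam_gt0.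
have [M [_ lawZ]] := product_law_ge_subexponential j hindep hdens hsym hx0 hA hB hbeta
  hhazard htail rholam a0.
pose N := (Num.truncn `|M|).+1.
have MN : M < N%:R by exact: le_lt_trans (ler_norm M) (truncnS_gt _).
have N1 : 1 <= N%:R :> R by rewrite ler1n.
(* the law as a probability on the type that carries the Lebesgue measure *)
have mZ : measurable_fun setT (product_RV P xi : T -> measurableTypeR R).
  exact: (measurable_funPT (product_RV P xi)).
pose Z : {mfun T >-> measurableTypeR R} :=
  HB.pack (product_RV P xi : T -> measurableTypeR R)
    (isMeasurableFun.Build _ _ _ (measurableTypeR R) _ mZ).
pose nu : probability (measurableTypeR R) R :=
  @distribution _ _ T (measurableTypeR R) R P Z.
have pos : forall A, measurable A ->
    (0 <= nu A + \int[lebesgue_measure]_(x in A) (odd_bump N%:R lam x)%:E)%E.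
  have := @odd_bump_perturbation_ge0 R lam N nu isT lam0 lam12.
  apply => m S Nm mS Sm.
  apply: (lawZ m%:R) => //; first by rewrite (lt_le_trans MN)// ler_nat.
  move=> z /Sm /andP[mz zm]; rewrite /= mz/= (le_trans (ltW zm))//.
  by rewrite -natr1 mulr_natl mulr2n lerD2l ler1n (leq_trans _ Nm).
have intk k : lebesgue_measure.-integrable setT
    (fun x : R => (x ^+ k * odd_bump N%:R lam x)%:E).
  exact: integrable_odd_bump.
have int1 : lebesgue_measure.-integrable setT (EFin \o odd_bump (R := R) N%:R lam).
  by apply: eq_integrable (intk 0) => // x _ /=; rewrite expr0 mul1r.
have int0 : (\int[lebesgue_measure]_x (odd_bump (R := R) N%:R lam x)%:E = 0)%E.
  rewrite -[RHS](integral_odd_bump0 N1 lam0 lam12 0).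
  by apply: eq_integral => x _; rewrite expr0 mul1r.
have momQ : has_moment_sequence (perturbed_probability int1 pos int0)
    (moment P (product_RV P xi)).
  move=> k k0.
  have mk : measurable_fun setT (fun x : measurableTypeR R => x ^+ k).
    exact: exprn_measurable.
  have mkE : measurable_fun setT (EFin \o (fun x : measurableTypeR R => x ^+ k)).
    exact/measurable_EFinP.
  have nuk : nu.-integrable setT (EFin \o (fun x : measurableTypeR R => x ^+ k)).
    by apply: integrable_pushforward => //; rewrite preimage_setT; exact: hmomZ.
  have [Qk ->] := integral_perturbed_probability int1 pos int0 mk nuk (intk k)
    (integral_odd_bump0 N1 lam0 lam12 k).
  split; first exact: Qk.
  rewrite /moment unlock; apply: (integral_distribution (X := Z) mkE).
  exact: hmomZ.
have [S mS] := odd_bump_neq0 N1 lam0 lam12; apply/negP; rewrite negbK.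
have fS : nu S \is a fin_num by exact: fin_num_measure.
have := uniq _ momQ S mS; rewrite [LHS]perturbed_probabilityE// addeC => E.
by rewrite -[X in X == _](addeK _ fS) E subee.
Qed.
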